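(* Let $D\subset\mathbb{R}^d$ be compact, let $A\in C(D,\mathbb{R}^{m\times n})$, and let $\Omega$ be an $n\times(r+p)$ Gaussian random matrix (not depending on $t$) with integers $r\ge 2$, $p\ge 2$. Then $$\mathbb{E}\Big[\int_{D}\|(I-\mathcal{P}_{A(t)\Omega})A(t)\|^2_F\,\mathrm{d}t\Big]\leq \Big(1+\frac{r}{p-1}\Big)\Big(\int_{D}\sum_{j> r}\sigma_j\big(A(t)\big)^2\,\mathrm{d}t\Big).$$
   Context: $C(D,\mathbb{R}^{m\times n})$ is the set of continuous functions from $D$ to $\mathbb{R}^{m\times n}$. A Gaussian random matrix is a matrix whose entries are i.i.d. standard normal random variables. For a real matrix $M$, $\mathcal{P}_M:=MM^\dagger$ is the orthogonal projector onto the column space of $M$, where $\dagger$ denotes the Moore–Penrose pseudoinverse; so $\mathcal{P}_{A(t)\Omega}=(A(t)\Omega)(A(t)\Omega)^\dagger$. $\|\cdot\|_F$ is the Frobenius norm and $\sigma_1(M)\ge\sigma_2(M)\ge\cdots$ are the singular values of $M$ (the sum over $j>r$ runs over $r<j\le\min\{m,n\}$, an empty sum being $0$). Integration over $D$ is with respect to Lebesgue measure. *)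

(* Defs.v *)
(* MathComp and MathComp-Analysis, over an arbitrary R : realType. *)
From HB Require Import structures.
From mathcomp Require Import all_boot all_order all_algebra.
From mathcomp Require Import all_classical all_reals all_analysis.
From mathcomp Require Import measurable_realfun.
From mathcomp Require complex.

Set Implicit Arguments.
Unset Strict Implicit.
Unset Printing Implicit Defensive.

Import Order.TTheory GRing.Theory Num.Theory.
Import numFieldNormedType.Exports.

Local Open Scope classical_set_scope.
Local Open Scope ring_scope.

Section matrix_notions.
Context {R : realType}.

Definition frobenius_norm m n (M : 'M[R]_(m, n)) : R :=
  Num.sqrt (\sum_i \sum_j M i j ^+ 2).

(* The four Penrose equations, which have exactly one solution X for each M:
   see [penrose_exists] and [penrose_uniq]. *)
Definition penrose m n (M : 'M[R]_(m, n)) (X : 'M[R]_(n, m)) : Prop :=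
  [/\ M *m X *m M = M, X *m M *m X = X,
      (M *m X)^T = M *m X & (X *m M)^T = X *m M].

Definition moore_penrose m n (M : 'M[R]_(m, n)) : 'M[R]_(n, m) :=
  xget 0 [set X | penrose M X].

Definition col_projector m n (M : 'M[R]_(m, n)) : 'M[R]_m :=
  M *m moore_penrose M.

(* s lists the eigenvalues of S in nonincreasing order, repeated according to
   algebraic multiplicity; such an s exists only if char_poly S splits over R,
   which holds for symmetric S ([eigenvaluesP]), the only case used below. *)
Definition eigenvalue_seq n (S : 'M[R]_n) (s : seq R) : Prop :=
  sorted >=%R s /\ char_poly S = \prod_(x <- s) ('X - x%:P).

Definition eigenvalues n (S : 'M[R]_n) : seq R :=
  xget [::] [set s | eigenvalue_seq S s].

(* M^T *m M has n eigenvalues; when m < n the last n - m of them are 0 and do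
   not count as singular values. *)
Definition singular_values m n (M : 'M[R]_(m, n)) : seq R :=
  take (minn m n) [seq Num.sqrt x | x <- eigenvalues (M^T *m M)].

(* j is counted from 1: singular_value 1 M is the largest singular value. *)
Definition singular_value (j : nat) m n (M : 'M[R]_(m, n)) : R :=
  nth 0 (singular_values M) j.-1.

End matrix_notions.

Section matrix_notions_theory.
Context {R : realType}.

Lemma penrose_uniq m n (M : 'M[R]_(m, n)) X Y :
  penrose M X -> penrose M Y -> X = Y.
Proof.
move=> [MX1 XM1 MX XM] [MY1 YM1 MY YM].
have E1 : M *m X = M *m Y.
  rewrite -[LHS]MX -{1}MY1 -mulmxA trmx_mul MX MY.
  by rewrite mulmxA MX1.
have E2 : X *m M = Y *m M.
  rewrite -[LHS]XM -{1}MY1 -mulmxA mulmxA trmx_mul XM YM.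
  by rewrite mulmxA -(mulmxA Y M X) -(mulmxA Y) MX1.
by rewrite -XM1 E2 -mulmxA E1 mulmxA YM1.
Qed.

Let mulmx_trl_eq0 k l (B : 'M[R]_(k, l)) (u : 'rV[R]_k) :
  u *m (B *m B^T) = 0 -> u *m B = 0.
Proof.
move=> uBB.
have : \sum_j (u *m B) 0 j ^+ 2 = 0.
  transitivity ((u *m B *m (u *m B)^T) 0 0).
    by rewrite mxE; apply: eq_bigr => j _; rewrite !mxE expr2.
  by rewrite trmx_mul mulmxA -[u *m B *m _]mulmxA uBB mul0mx mxE.
move/eqP; rewrite psumr_eq0; last by move=> j _; exact: sqr_ge0.
move=> /allP H; apply/rowP => j; rewrite [RHS]mxE; apply/eqP.
by rewrite -sqrf_eq0; apply: H; rewrite mem_index_enum.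
Qed.

Let row_free_gram_unit k l (B : 'M[R]_(k, l)) :
  row_free B -> B *m B^T \in unitmx.
Proof.
move=> fB; rewrite -row_free_unit -kermx_eq0; apply/eqP/row_matrixP => i.
rewrite row0; apply: (row_free_inj fB); rewrite mul0mx.
by apply: mulmx_trl_eq0; rewrite -row_mul mulmx_ker row0.
Qed.

Lemma penrose_exists m n (M : 'M[R]_(m, n)) : exists X, penrose M X.
Proof.
have [k [C [F [-> CCu FFu]]]] : exists k (C : 'M[R]_(m, k)) (F : 'M[R]_(k, n)),
    [/\ M = C *m F, C^T *m C \in unitmx & F *m F^T \in unitmx].
  exists (\rank M), (col_base M), (row_base M); split.
  - by rewrite mulmx_base.
  - rewrite -[X in _ *m X]trmxK; apply: row_free_gram_unit.
    by rewrite /row_free mxrank_tr; have := col_base_full M.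
  - by apply: row_free_gram_unit; exact: row_base_free.
pose FF := F *m F^T; pose CC := C^T *m C.
have FFs : (invmx FF)^T = invmx FF by rewrite trmx_inv trmx_mul trmxK.
have CCs : (invmx CC)^T = invmx CC by rewrite trmx_inv trmx_mul trmxK.
exists (F^T *m invmx FF *m (invmx CC *m C^T)).
have MX : C *m F *m (F^T *m invmx FF *m (invmx CC *m C^T)) =
    C *m invmx CC *m C^T.
  by rewrite !mulmxA -(mulmxA C F) -/FF -(mulmxA C FF) mulmxV// mulmx1.
have XM : F^T *m invmx FF *m (invmx CC *m C^T) *m (C *m F) =
    F^T *m invmx FF *m F.
  rewrite !mulmxA -(mulmxA _ C^T C) -/CC -(mulmxA _ (invmx CC) CC) mulVmx//.
  by rewrite mulmx1.
split.
- rewrite MX !mulmxA -(mulmxA _ C^T C) -/CC -(mulmxA _ (invmx CC) CC) mulVmx//.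
  by rewrite mulmx1.
- rewrite XM !mulmxA -(mulmxA _ F F^T) -/FF -(mulmxA _ (invmx FF) FF) mulVmx//.
  by rewrite mulmx1.
- by rewrite MX !trmx_mul trmxK CCs mulmxA.
- by rewrite XM !trmx_mul trmxK FFs mulmxA.
Qed.

Lemma moore_penroseP m n (M : 'M[R]_(m, n)) : penrose M (moore_penrose M).
Proof. by apply: xgetPex; exact: penrose_exists. Qed.

Lemma eigenvalue_seq_uniq n (S : 'M[R]_n) s1 s2 :
  eigenvalue_seq S s1 -> eigenvalue_seq S s2 -> s1 = s2.
Proof.
move=> [ss1 E1] [ss2]; rewrite E1 => /prod_XsubC_eq.
apply: (@sorted_eq _ >=%R) => //; first by move=> y x z xy yz; exact: le_trans yz xy.
by move=> x y /andP[yx xy]; apply/le_anti/andP.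
Qed.

Section complexification.
Import complex.

Lemma eigenvalue_seq_exists n (S : 'M[R]_n) : S^T = S ->
  exists s, eigenvalue_seq S s.
Proof.
move=> symS; pose f := real_complex R.
pose Sc := map_mx f S.
have Sc_herm : Sc \is hermsymmx.
  apply: realsym_hermsym.
    by apply/is_hermitianmxP; rewrite expr0 scale1r map_mx_id// map_trmx symS.
  by apply/mxOverP => i j; rewrite mxE complex.complex_real.
pose P := spectralmx Sc; pose D := spectral_diag Sc.
have Pu : P \in unitmx := spectral_unit Sc.
have DE i : D ord0 i = f (complex.Re (D ord0 i)).
  by have /mxOverP/(_ ord0 i)/complex.RRe_real := hermitian_spectral_diag_real Sc_herm.
have cSc : char_poly Sc = \prod_(i < n) ('X - (D ord0 i)%:P).
  rewrite (orthomx_spectralP (hermitian_normalmx Sc_herm)) -/P -/D.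
  have -> : char_poly (invmx P *m diag_mx D *m P) = char_poly (diag_mx D).
    rewrite /char_poly; pose Q := map_mx polyC P.
    have -> : char_poly_mx (invmx P *m diag_mx D *m P) =
        map_mx polyC (invmx P) *m char_poly_mx (diag_mx D) *m Q.
      rewrite /char_poly_mx mulmxBr mulmxBl -!map_mxM; congr (_ - _).
      by rewrite scalar_mxC -mulmxA -map_mxM mulVmx// map_mx1 mulmx1.
    rewrite !det_mulmx mulrC mulrA -det_mulmx -map_mxM mulmxV//.
    by rewrite map_mx1 det1 mul1r.
  rewrite char_poly_trig; last exact: diag_mx_is_trig.
  by apply: eq_bigr => i _; rewrite mxE eqxx mulr1n.
exists (sort >=%R [seq complex.Re (D ord0 i) | i <- enum 'I_n]); split.
  by apply: sort_sorted => x y; exact: le_total.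
rewrite (perm_big [seq complex.Re (D ord0 i) | i <- enum 'I_n])/=; last by rewrite perm_sort.
apply: (map_poly_inj f); rewrite map_char_poly -/Sc cSc rmorph_prod/= big_map big_enum/=.
by apply: eq_bigr => i _; rewrite -(map_polyX f) [in LHS]DE -map_polyC -rmorphB.
Qed.

End complexification.

Lemma eigenvaluesP n (S : 'M[R]_n) : S^T = S ->
  eigenvalue_seq S (eigenvalues S).
Proof. by move=> symS; apply: xgetPex; exact: eigenvalue_seq_exists. Qed.

Lemma size_eigenvalues n (S : 'M[R]_n) : S^T = S -> size (eigenvalues S) = n.
Proof.
move=> /eigenvaluesP[_ /(congr1 (fun p : {poly R} => size p))].
by rewrite size_char_poly size_prod_XsubC => -[].
Qed.

Lemma eigenvalues_gram_ge0 m n (M : 'M[R]_(m, n)) x :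
  x \in eigenvalues (M^T *m M) -> 0 <= x.
Proof.
have sym : (M^T *m M)^T = M^T *m M by rewrite trmx_mul trmxK.
have [_ E] := eigenvaluesP sym.
rewrite -root_prod_XsubC -E -eigenvalue_root_char => /eigenvalueP[v vE v0].
have sq k (u : 'rV[R]_k) : (u *m u^T) 0 0 = \sum_j u 0 j ^+ 2.
  by rewrite mxE; apply: eq_bigr => j _; rewrite mxE expr2.
have vv_gt0 : 0 < (v *m v^T) 0 0.
  rewrite sq lt_def sumr_ge0 ?andbT; last by move=> j _; exact: sqr_ge0.
  apply: contra v0; rewrite psumr_eq0; last by move=> j _; exact: sqr_ge0.
  move=> /allP H; apply/eqP/rowP => j; rewrite [RHS]mxE; apply/eqP.
  by rewrite -sqrf_eq0; apply: H; rewrite mem_index_enum.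
rewrite -(pmulr_lge0 _ vv_gt0).
have -> : x * (v *m v^T) 0 0 = (v *m M^T *m (v *m M^T)^T) 0 0.
  by rewrite trmx_mul trmxK !mulmxA -(mulmxA v) vE -scalemxAl [RHS]mxE.
by rewrite sq sumr_ge0// => j _; exact: sqr_ge0.
Qed.

Lemma size_singular_values m n (M : 'M[R]_(m, n)) :
  size (singular_values M) = minn m n.
Proof.
rewrite size_takel// size_map size_eigenvalues ?geq_minr//.
by rewrite trmx_mul trmxK.
Qed.

End matrix_notions_theory.

(* R^d with its Borel sigma-algebra; convertible to 'rV[R]_d. *)
Definition borel_rV (R : realType) (d : nat) :=
  g_sigma_algebraType (@open 'rV[R]_d).

Definition rV_cons (R : realType) (d : nat)
    (p : measurableTypeR R * borel_rV R d) : borel_rV R d.+1 :=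
  row_mx (p.1 : R)%:M (p.2 : 'rV[R]_d) : 'rV[R]_(1 + d).

(* d-dimensional Lebesgue measure on Borel sets: the d-fold product of the
   one-dimensional one, transported to row vectors; see [lebesgue_rV_box]. *)
Fixpoint lebesgue_rV (R : realType) (d : nat) : set (borel_rV R d) -> \bar R :=
  match d with
  | 0 => @dirac _ (borel_rV R 0) (0 : 'rV[R]_0) R
  | d'.+1 => pushforward (lebesgue_measure \x @lebesgue_rV R d')%E (@rV_cons R d')
  end.
Arguments lebesgue_rV : clear implicits.

Section lebesgue_rV_theory.
Context {R : realType}.

Lemma open_measurable_rV d (U : set 'rV[R]_d) :
  open U -> measurable (U : set (borel_rV R d)).
Proof. by move=> oU; exact: sub_sigma_algebra. Qed.

Lemma measurable_rV_cons d : measurable_fun setT (@rV_cons R d).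
Proof.
apply: (@measurability _ _ _ (borel_rV R d.+1) _ _ (@open 'rV[R]_d.+1)) => //.
move=> _ [U oU <-]; rewrite setTI.
pose box (a : rat * 'rV[rat]_d * nat) : set (measurableTypeR R * borel_rV R d) :=
  ball (ratr a.1.1 : R) a.2.+1%:R^-1 `*`
  ball (map_mx ratr a.1.2 : 'rV[R]_d) a.2.+1%:R^-1.
pose F a := if `[< box a `<=` @rV_cons R d @^-1` U >] then box a else set0.
rewrite (_ : _ @^-1` _ = \bigcup_a F a); last first.
  apply/seteqP; split => [[x v] /= Uxv|z [a _]]; last first.
    by rewrite /F; case: asboolP => // + baz; exact.
  have [e e0 eU] : exists2 e : R, 0 < e &
      ball (rV_cons (x, v) : 'rV[R]_d.+1) e `<=` U.
    by move: oU; rewrite openE => /(_ _ Uxv); rewrite /interior -nbhs_ballE => -[e e0 ?]; exists e.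
  have e20 : 0 < e / 2 by rewrite divr_gt0.
  have [k _ /(_ _ (leqnn _)) /= ke] := near_infty_natSinv_lt (PosNum e20).
  have k0 : (0 : R) < k.+1%:R^-1 by rewrite invr_gt0.
  have approx (y : R) : exists q : rat, `|ratr q - y| < k.+1%:R^-1.
    have [|q] := @rat_in_itvoo R (y - k.+1%:R^-1) (y + k.+1%:R^-1).
      by rewrite ltrBlDr -addrA ltrDl addr_gt0.
    by rewrite in_itv/= => qy; exists q; rewrite ltr_distl.
  have [q qx] := approx x.
  have [c cv] := choice (fun i => approx ((v : 'rV[R]_d) ord0 i)).
  exists (q, \row_i c i, k) => //; rewrite /F; case: asboolP => [_|[]].
    split => /=; first by rewrite -ball_normE.
    by split => // i j; rewrite !mxE -ball_normE/= ord1.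
  move=> [y w] [/= qy [_ cw]]; apply: eU; split => // i j.
  rewrite ord1; move: j.
  suff H (j : 'I_(1 + d)) :
    ball ((row_mx (x : R)%:M (v : 'rV_d) : 'rV[R]_(1 + d)) 0 j) e
      ((row_mx (y : R)%:M (w : 'rV_d) : 'rV[R]_(1 + d)) 0 j) by exact: H.
  have ee : k.+1%:R^-1 + k.+1%:R^-1 <= e.
    by rewrite [leRHS]splitr lerD// ltW.
  apply: (le_ball ee); case: (split_ordP j) => l ->.
    rewrite !row_mxEl !mxE ord1 eqxx !mulr1n.
    apply: (@ball_triangle _ _ (ratr q : R)) => //.
    by apply: ball_sym; rewrite -ball_normE.
  rewrite !row_mxEr; apply: (@ball_triangle _ _ (ratr (c l) : R)) => //.
    by apply: ball_sym; rewrite -ball_normE; exact: cv.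
  by have := cw ord0 l; rewrite !mxE.
apply: countable_bigcupT_measurable => [|a]; first exact: countableP.
rewrite /F; case: ifP => // _.
apply: measurableX.
  by apply: (@open_measurable R); exact: (@ball_open R R^o).
by apply: open_measurable_rV; exact: (@ball_open R 'rV[R]_d).
Qed.

Lemma measurable_rV_head d :
  measurable_fun setT (fun v : borel_rV R d.+1 =>
    (v : 'rV[R]_d.+1) ord0 ord0 : measurableTypeR R).
Proof.
apply: (measurability _ (RGenOpens.measurableE R)) => _ [_ [a [b ->]] <-].
rewrite setTI; apply: open_measurable_rV.
apply: open_comp; last exact: interval_open.
by move=> v _; exact: coord_continuous.
Qed.

Lemma measurable_rV_tail d :
  measurable_fun setT (fun v : borel_rV R d.+1 =>
    rsubmx (v : 'rV[R]_(1 + d)) : borel_rV R d).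
Proof.
apply: (@measurability _ _ _ (borel_rV R d) _ _ (@open 'rV[R]_d)) => //.
move=> _ [U oU <-]; rewrite setTI; apply: open_measurable_rV.
apply: (@open_comp 'rV[R]_(1 + d) 'rV[R]_d rsubmx) => // v _ B.
move=> [Q Qv QB]; exists (fun i j => if fintype.split (j : 'I_(1 + d)) is inr l then Q i l else setT).
  move=> i j; case: split_ordP => l jl; first exact: filterT.
  by have := Qv i l; rewrite mxE jl.
move=> w /= Qw; apply: QB => i l; have := Qw i (rshift 1 l).
by rewrite (unsplitK (inr l)) mxE.
Qed.

Lemma rV_cons0 d (x : R) (v : 'rV[R]_d) :
  (@rV_cons R d (x, v) : 'rV[R]_d.+1) ord0 ord0 = x.
Proof.
transitivity ((row_mx x%:M v : 'rV[R]_(1 + d)) 0 (lshift d 0)).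
  by congr (fun_of_matrix _ _ _); exact/val_inj.
by rewrite row_mxEl mxE eqxx.
Qed.

Lemma rV_cons_box d (A : set R) (B : set 'rV[R]_d) :
  @rV_cons R d @^-1` [set v | A ((v : 'rV[R]_d.+1) ord0 ord0) /\
                             B (rsubmx (v : 'rV[R]_(1 + d)))] = A `*` B.
Proof.
by apply/seteqP; split=> -[x v] /=; rewrite rV_cons0 /rV_cons row_mxKr.
Qed.

Lemma measurable_rV_box d (A : set R) (B : set 'rV[R]_d) :
  measurable A -> measurable (B : set (borel_rV R d)) ->
  measurable ([set v | A ((v : 'rV[R]_d.+1) ord0 ord0) /\
    B (rsubmx (v : 'rV[R]_(1 + d)))] : set (borel_rV R d.+1)).
Proof.
move=> mA mB; apply: measurableI.
  by rewrite -[X in measurable X]setTI; exact: measurable_rV_head.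
by rewrite -[X in measurable X]setTI; exact: measurable_rV_tail.
Qed.

End lebesgue_rV_theory.

Section lebesgue_step.
Context {R : realType} {d : nat}.
Variable mu : {sigma_finite_measure set (borel_rV R d) -> \bar R}.

Definition leb_step : set (borel_rV R d.+1) -> \bar R :=
  pushforward (lebesgue_measure \x mu)%E (@rV_cons R d).

HB.instance Definition _ := Measure.copy leb_step
  (measure_function_pushforward__canonical__measure_function_Measure
    (lebesgue_measure \x mu)%E (@measurable_rV_cons R d)).

Lemma leb_step_box (A : set R) (B : set 'rV[R]_d) :
  measurable A -> measurable (B : set (borel_rV R d)) ->
  leb_step [set v | A ((v : 'rV[R]_d.+1) ord0 ord0) /\
                    B (rsubmx (v : 'rV[R]_(1 + d)))] =
  (lebesgue_measure A * mu B)%E.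
Proof.
by move=> mA mB; rewrite /leb_step /pushforward rV_cons_box product_measure1E.
Qed.

Let leb_step_sigma_finite : sigma_finite setT leb_step.
Proof.
have /sigma_finiteP[F [TF ndF Foo]] := sigma_finiteT (@lebesgue_measure R).
have /sigma_finiteP[G [TG ndG Goo]] := sigma_finiteT mu.
exists (fun n => [set v | F n ((v : 'rV[R]_d.+1) ord0 ord0) /\
                          G n (rsubmx (v : 'rV[R]_(1 + d)))]).
  apply/esym/seteqP; split => // v _.
  have : setT ((v : 'rV[R]_d.+1) ord0 ord0) by [].
  rewrite TF => -[n _ Fn].
  have : setT (rsubmx (v : 'rV[R]_(1 + d)) : borel_rV R d) by [].
  rewrite TG => -[k _ Gk]; exists (maxn n k) => //; split.
    by move: Fn; exact/subsetPset/ndF/leq_maxl.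
  by move: Gk; exact/subsetPset/ndG/leq_maxr.
move=> k; have [? ?] := Foo k; have [? ?] := Goo k.
split; first exact: measurable_rV_box.
by rewrite leb_step_box// lte_mul_pinfty// ge0_fin_numE.
Qed.

HB.instance Definition _ :=
  Measure_isSigmaFinite.Build _ _ _ leb_step leb_step_sigma_finite.

End lebesgue_step.

Lemma lebesgue_rV_sigma_finite (R : realType) d :
  {mu : {sigma_finite_measure set (borel_rV R d) -> \bar R} |
    lebesgue_rV R d = mu}.
Proof.
elim: d => [|d [mu muE]] /=.
  by exists (@dirac _ (borel_rV R 0) (0 : 'rV[R]_0) R).
by rewrite muE; exists (leb_step mu).
Qed.

Section lebesgue_rV_measure.
Context {R : realType} {d : nat}.
Let leb := lebesgue_rV R d.

Let leb0 : leb set0 = 0%E.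
Proof. by rewrite /leb; have [mu ->] := lebesgue_rV_sigma_finite R d; exact: measure0. Qed.

Let leb_ge0 A : (0 <= leb A)%E.
Proof. by rewrite /leb; have [mu ->] := lebesgue_rV_sigma_finite R d. Qed.

Let leb_sigma_additive : semi_sigma_additive leb.
Proof.
rewrite /leb; have [mu ->] := lebesgue_rV_sigma_finite R d.
exact: measure_semi_sigma_additive.
Qed.

HB.instance Definition _ := isMeasure.Build _ _ _ (lebesgue_rV R d)
  leb0 leb_ge0 leb_sigma_additive.

Let leb_sigma_finite : sigma_finite setT leb.
Proof.
rewrite /leb; have [mu ->] := lebesgue_rV_sigma_finite R d.
exact: sigma_finiteT.
Qed.

HB.instance Definition _ :=
  Measure_isSigmaFinite.Build _ _ _ (lebesgue_rV R d) leb_sigma_finite.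

End lebesgue_rV_measure.

Lemma lebesgue_rV_box (R : realType) d (B : 'I_d -> set R) :
  (forall i, measurable (B i)) ->
  measurable ([set v | forall i, B i ((v : 'rV[R]_d) ord0 i)] : set (borel_rV R d)) /\
  lebesgue_rV R d [set v | forall i, B i ((v : 'rV[R]_d) ord0 i)] =
  (\prod_i lebesgue_measure (B i))%E.
Proof.
elim: d B => [|d IH] B mB.
  rewrite big_ord0 (_ : [set _ | _] = setT).
    split; first exact: (@measurableT _ (borel_rV R 0)).
    exact: (@diracT _ (borel_rV R 0)).
  by apply/seteqP; split => // v _ [].
have [mB' muB] := IH (fun i => B (lift ord0 i)) (fun i => mB _).
set C := [set v | _] in mB' muB.
rewrite (_ : [set _ | _] = [set v | B ord0 ((v : 'rV[R]_d.+1) ord0 ord0) /\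
    C (rsubmx (v : 'rV[R]_(1 + d)))]).
  split; first exact: measurable_rV_box.
  rewrite big_ord_recl -muB.
  exact: (leb_step_box (lebesgue_rV R d)).
have rl (i : 'I_d) : rshift 1 i = lift ord0 i by exact/val_inj.
apply/seteqP; split => v /= => [Bv|[B0 Cv] i].
  by split => // i; rewrite mxE rl.
have [j ->|-> //] := unliftP ord0 i.
by have := Cv j; rewrite mxE rl.
Qed.

Section gaussian.
Context {dT : measure_display} {T : measurableType dT} {R : realType}.
Variable P : probability T R.

Definition mutually_independent (I : finType) (X : I -> T -> R) : Prop :=
  forall (J : {set I}) (B : I -> set R), (forall i, measurable (B i)) ->
    P (\bigcap_(i in [set` J]) (X i @^-1` B i)) =
    (\prod_(i in J) P (X i @^-1` B i))%E.

(* The second parameter of [normal_prob] is the standard deviation. *)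
Definition gaussian_matrix n l (Omega : T -> 'M[R]_(n, l)) : Prop :=
  [/\ forall i j, measurable_fun setT (fun w => Omega w i j),
      forall i j (B : set R), measurable B ->
        P [set w | B (Omega w i j)] = normal_prob 0 1 B &
      mutually_independent (fun (ij : 'I_n * 'I_l) w => Omega w ij.1 ij.2)].

End gaussian.

(* Main.v *)
(* The residual is ||(I - P_{A O})A||_F^2 = min_X ||A - A O X||_F^2. Let the
   columns of V be the right singular vectors of the r largest singular values
   of A, put B = A - A V V^T and G = V^T O, and take X = K V^T with
   K = G^T (G G^T + e)^-1. By orthogonality the residual is at most
   ||B||^2 + ||B O K||^2 + O(e), where ||B||^2 is the tail sum of squared
   singular values. Both expectations are computed by Gaussian integration by
   parts, E[O_ij H(O)] = E[(d H / d O_ij)(O)], so neither rotation invariance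
   nor the inverse Wishart law is needed:
   - as K depends on O only through V^T O and B V = 0, the field
     H = B^T B O K K^T gives E ||B O K||^2 = ||B||^2 E ||K||^2, while
     ||K||^2 <= tr (G G^T + e)^-1;
   - the field H = V K^T gives E tr (G G^T + e)^-1 <= r / (p - 1).
   Then e tends to 0, and Tonelli's theorem exchanges the expectation with the
   integral over D. Joint measurability of the residual holds because the
   minimum over X is an infimum over rational matrices. *)
Require Import Defs.
From HB Require Import structures.
From mathcomp Require Import all_boot all_order all_algebra.
From mathcomp Require Import all_classical all_reals all_analysis.
From mathcomp Require Import measurable_realfun.
From mathcomp Require Import perm ring lra.

Set Implicit Arguments.
Unset Strict Implicit.
Unset Printing Implicit Defensive.

Import Order.TTheory GRing.Theory Num.Theory.
Import numFieldNormedType.Exports.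

Local Open Scope classical_set_scope.
Local Open Scope ring_scope.

(** * Gaussian integration by parts *)

(** Integration by parts needs fields whose values and partial derivatives grow at most linearly.
    The true pseudoinverse of G is unbounded near rank-deficient G; with e > 0 the entries of K and
    of W = (G G^T + e)^-1 are bounded by constants depending on e only, at the price of the defect
    in G K = 1 - e W. The constant p - 1 comes from the divergence of the field V K^T. Let l = r + p
    and let q = min(r, n) be the number of columns of V (r may exceed n). The divergence is l tr W -
    ||K||^2 - tr (K G) tr W, where ||K||^2 <= tr W and tr (K G) = q - e tr W, so it is at least (l -
    q - 1) tr W. The pairing of the field with O is tr (K G) <= q. Hence E tr W <= q / (l - q - 1)
    <= r / (p - 1). *)

Section gaussian_stein.
Context {R : realType}.
Local Notation mu := (@lebesgue_measure R).
Local Notation nu := (@normal_prob R 0 1).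
Local Notation phi := (@normal_pdf R 0 1).

Lemma normal_pdf01E (x : R) : phi x = normal_peak 1 * expR (- (x ^+ 2 / 2)).
Proof.
by rewrite normal_pdfE ?oner_eq0// /normal_fun subr0 expr1n mulNr.
Qed.

(** The change of variables involves the Radon-Nikodym derivative of [nu]; it agrees with [phi]
    almost everywhere because both integrate to [nu] over every measurable set. *)
Lemma integral_normal_prob (f : R -> \bar R) : nu.-integrable setT f ->
  (\int[nu]_x f x = \int[mu]_x (f x * (phi x)%:E))%E.
Proof.
move=> intf.
have dom := @normal_prob_dominates R 0 1.
rewrite -(Radon_Nikodym_change_of_variables dom)//=.
have mf := measurable_int _ intf.
apply: ae_eq_integral => //.
1,2: by apply: emeasurable_funM => //; apply/measurable_EFinP; exact: measurable_normal_pdf.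
apply: ae_eqe_mul2l => /=.
rewrite Radon_NikodymE//=; case: cid => /= h [h1 h2 h3].
apply: integral_ae_eq => //=.
- by apply/measurable_EFinP; exact: measurable_normal_pdf.
- by move=> E _ mE; rewrite -h3.
Qed.

(** Truncation at n makes [f] bounded, hence integrable, and monotone convergence removes the
    truncation. This form can be used to prove integrability. *)
Lemma ge0_integral_normal_prob (f : R -> R) : measurable_fun setT f ->
  (forall x, 0 <= f x) ->
  (\int[nu]_x (f x)%:E = \int[mu]_x (f x * phi x)%:E)%E.
Proof.
move=> mf f0.
pose g n x := Num.min (f x) n%:R.
have mg n : measurable_fun setT (g n) by exact: measurable_minr.
have g0 n x : 0 <= g n x by rewrite le_min f0 ler0n.
have gcvg x : (g n x) @[n --> \oo] --> f x.
  apply: cvg_near_cst; near=> n; rewrite /g min_l//.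
  by near: n; exact: nbhs_infty_ger.
have gnd x m n : (m <= n)%N -> g m x <= g n x.
  by move=> mn; rewrite /g le_min ge_min lexx/= ge_min ler_nat mn orbT.
transitivity (limn (fun n => \int[nu]_x (g n x)%:E)%E).
  rewrite -monotone_convergence//=.
  - apply: eq_integral => x _; apply/esym/cvg_lim => //.
    by apply: cvg_EFin; [exact: nearW|exact: gcvg].
  - by move=> n; apply: measurableT_comp; last exact: mg.
  - by move=> n x _; rewrite lee_fin.
  - by move=> x _ m n mn; rewrite lee_fin gnd.
transitivity (limn (fun n => \int[mu]_x (g n x * phi x)%:E)%E).
  apply: congr_lim; apply/funext => n.
  rewrite integral_normal_prob//.
  apply: (@le_integrable _ _ _ nu _ measurableT _ (cst n%:R%:E)) => //=.
  - by apply: measurableT_comp; last exact: mg.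
  - by move=> x _; rewrite lee_fin !ger0_norm ?ler0n// ge_min lexx orbT.
  - exact: finite_measure_integrable_cst.
rewrite -monotone_convergence//=.
- apply: eq_integral => x _; apply/cvg_lim => //.
  apply: cvg_EFin; first exact: nearW.
  by apply: cvgM; [exact: gcvg|exact: cvg_cst].
- move=> n; apply/measurable_EFinP.
  by apply: measurable_funM; [exact: mg|exact: measurable_normal_pdf].
- by move=> n x _; rewrite lee_fin mulr_ge0// normal_pdf_ge0.
- by move=> x _ m n mn; rewrite lee_fin ler_wpM2r ?normal_pdf_ge0 ?gnd.
Unshelve. all: by end_near. Qed.

(** Half of the exponent absorbs the square: y <= exp y at y = x^2 / 4 gives x^2 exp (- x^2 / 4) <=
    4, and what remains is a multiple of the density of standard deviation sqrt 2, with [c] the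
    ratio of the normalizations. *)
Lemma normal_prob_sqr_lty : (\int[nu]_x (x ^+ 2)%:E < +oo)%E.
Proof.
rewrite ge0_integral_normal_prob; [|exact: exprn_measurable|by move=> x; exact: sqr_ge0].
pose s : R := Num.sqrt 2.
have s2 : s ^+ 2 = 2 by rewrite sqr_sqrtr.
have s0 : s != 0 by rewrite gt_eqF// sqrtr_gt0.
pose c : R := 4 * normal_peak 1 / normal_peak s.
have c0 : 0 <= c by rewrite !mulr_ge0 ?invr_ge0 ?normal_peak_ge0.
apply: (@le_lt_trans _ _ (\int[mu]_x (c%:E * (normal_pdf 0 s x)%:E)))%E.
  apply: ge0_le_integral => //=.
  - by move=> x _; rewrite lee_fin mulr_ge0 ?sqr_ge0 ?normal_pdf_ge0.
  - apply/measurable_EFinP; apply: measurable_funM; last exact: measurable_normal_pdf.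
    exact: exprn_measurable.
  - apply/measurable_EFinP; apply: measurable_funM => //.
    exact: measurable_normal_pdf.
  - move=> x _; rewrite lee_fin normal_pdf01E normal_pdfE// /normal_fun subr0 s2.
    rewrite (_ : 2 *+ 2 = 4 :> R); last by ring.
    have -> : c * (normal_peak s * expR (- x ^+ 2 / 4)) = 4 * normal_peak 1 * expR (-
        (x ^+ 2 / 4)).
      by rewrite /c mulNr; field; rewrite gt_eqF// normal_peak_gt0.
    have -> : - (x ^+ 2 / 2) = - (x ^+ 2 / 4) - (x ^+ 2 / 4) by field.
    rewrite expRD mulrA [X in _ <= X]mulrC [X in X <= _]mulrC.
    rewrite -mulrA ler_pM2l ?expR_gt0// mulrA.
    rewrite ler_wpM2r ?normal_peak_ge0// expRN mulrC ler_pdivrMr ?expR_gt0//.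
    have := expR_ge1Dx (x ^+ 2 / 4); lra.
rewrite integralZl//=; last exact: integrable_normal_pdf.
by rewrite integral_normal_pdf mule1 ltry.
Qed.

Lemma integrable_normal_prob (f : R -> R) (C : R) : measurable_fun setT f ->
  (forall x, `|f x| <= C * (1 + x ^+ 2)) -> nu.-integrable setT (EFin \o f).
Proof.
move=> mf fC.
apply: (@le_integrable _ _ _ nu _ measurableT _ (fun x => C%:E * (1%:E + (x ^+
    2)%:E))%E) => //=.
- exact/measurable_EFinP.
- by move=> x _; rewrite lee_fin (le_trans (fC x))// ler_norm.
- apply: integrableZl => //; apply: integrableD => //.
    exact: finite_measure_integrable_cst.
  apply/integrableP; split; first by apply/measurable_EFinP; exact: exprn_measurable.
  under eq_integral do rewrite gee0_abs ?lee_fin ?sqr_ge0//.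
  exact: normal_prob_sqr_lty.
Qed.

Lemma integrable_mul_normal_pdf (f : R -> R) : nu.-integrable setT (EFin \o f) ->
  mu.-integrable setT (fun x => (f x * phi x)%:E).
Proof.
move=> /integrableP[/measurable_EFinP mf foo]; apply/integrableP; split.
  by apply/measurable_EFinP; apply: measurable_funM => //; exact: measurable_normal_pdf.
move: foo; rewrite ge0_integral_normal_prob//; last exact: measurableT_comp.
congr (_ < _)%E; apply: eq_integral => x _ /=.
by rewrite normrM [`|phi x|]ger0_norm// normal_pdf_ge0.
Qed.

Lemma is_derive_normal_pdf (x : R) : is_derive x 1 phi (- x * phi x).
Proof.
rewrite (_ : phi = fun x => normal_peak 1 * expR (- (x ^+ 2 / 2))); last first.
  by apply/funext => y; exact: normal_pdf01E.
have H : is_derive x 1 ((- 2^-1) \*: (id ^+ 2 : R -> R)) (- x).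
  by apply: is_derive_eq; rewrite /GRing.scale/= expr1; field.
have -> : (fun y : R => normal_peak 1 * expR (- (y ^+ 2 / 2))) =
    normal_peak 1 \*: (expR \o ((- 2^-1) \*: (id ^+ 2 : R -> R))).
  by apply/funext => y /=; rewrite /GRing.scale/= mulNr [y ^+ 2 / 2]mulrC;
      congr (_ * expR (- (_ * _))); rewrite fctE.
apply: is_derive_eq; rewrite /GRing.scale/= fctE.
have -> : - 2^-1 *: x ^+ 2 = - (x ^+ 2 / 2) by rewrite /GRing.scale/= mulNr mulrC.
by ring.
Qed.

(** The function (h' - x h) phi is the derivative of h phi, which vanishes at infinity, so its
    integral over the line is 0. Linear growth of h and h' makes both integrands integrable. *)
Lemma stein_normal_prob (h h' : R -> R) (C : R) : (forall x : R, is_derive x 1 h (h' x)) ->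
  continuous h' -> (forall x, `|h x| <= C * (1 + `|x|)) ->
  (forall x, `|h' x| <= C * (1 + `|x|)) ->
  (\int[nu]_x (x * h x)%:E = \int[nu]_x (h' x)%:E)%E.
Proof.
move=> hh' ch' hC h'C.
have C0 : 0 <= C by have := le_trans (normr_ge0 _) (hC 0); rewrite normr0 addr0 mulr1.
have ch : continuous h.
  by move=> x; apply/differentiable_continuous/derivable1_diffP; case: (hh' x).
have mh : measurable_fun setT h by exact: continuous_measurable_fun.
have mh' : measurable_fun setT h' by exact: continuous_measurable_fun.
have int1 : nu.-integrable setT (EFin \o (fun x => x * h x)).
  apply: (@integrable_normal_prob _ (2 * C)); first exact: measurable_funM.
  move=> x; rewrite normrM; apply: (@le_trans _ _ (`|x| * (C * (1 + `|x|)))).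
    by rewrite ler_wpM2l.
  rewrite -[x ^+ 2]real_normK ?num_real//; have := normr_ge0 x.
  move: `|x| => y y0; rewrite mulrCA [2 * _]mulrC -mulrA ler_wpM2l//.
  have := sqr_ge0 (y - 1); nra.
have int2 : nu.-integrable setT (EFin \o h').
  apply: (@integrable_normal_prob _ (2 * C)) => // x.
  apply: (le_trans (h'C x)); rewrite [2 * _]mulrC -mulrA ler_wpM2l//.
  rewrite -[x ^+ 2]real_normK ?num_real//.
  have := sqr_ge0 (`|x| - 1); nra.
rewrite !integral_normal_prob//.
pose g x := h' x * phi x - x * h x * phi x.
pose F x := h x * phi x.
have FE (x : R) : is_derive x 1 F (g x).
  have d1 := is_derive_normal_pdf x; have d2 := hh' x.
  apply: is_derive_eq; rewrite /g /GRing.scale/=; ring.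
have intg : mu.-integrable setT (EFin \o g).
  rewrite [X in integrable _ _ X](_ : _ = (fun x => (h' x * phi x)%:E - (x * h x * phi
      x)%:E)%E); last first.
    by apply/funext => x /=; rewrite EFinB.
  by apply: integrableB => //; exact: integrable_mul_normal_pdf.
have cg : continuous g.
  have cphi := @continuous_normal_pdf R 0 1 (oner_neq0 _).
  move=> x; apply: cvgB; apply: cvgM.
  - exact: ch'.
  - exact: cphi.
  - by apply: cvgM; [exact: cvg_id|exact: ch].
  - exact: cphi.
(* Starting at n + 1 keeps the interval nondegenerate and its endpoints in the range where [Fb]
   applies. *)
have FTC n : (\int[mu]_(x in `[(- n.+1%:R)%R, n.+1%:R]) (g x)%:E = (F n.+1%:R)%:E - (F
    (- n.+1%:R))%:E)%E.
  have cF : continuous F.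
    by move=> x; apply/differentiable_continuous/derivable1_diffP; case: (FE x).
  apply: continuous_FTC2.
  - by rewrite gtrN.
  - exact: continuous_subspaceT.
  - split.
    + by move=> x _; case: (FE x).
    + by apply: cvg_at_right_filter; exact: cF.
    + by apply: cvg_at_left_filter; exact: cF.
  - by move=> x _; rewrite derive1E derive_val.
have lim1 : (\int[mu]_(x in `[(- n.+1%:R)%R, n.+1%:R]) (g x)%:E @[n --> \oo] -->
    \int[mu]_x (g x)%:E)%E.
  pose f_ n := (EFin \o g) \_ `[(- n.+1%:R : R), n.+1%:R].
  have -> : (fun n : nat => \int[mu]_(x in `[(- n.+1%:R)%R, n.+1%:R]) (g x)%:E)%E =
     (fun n => \int[mu]_x f_ n x)%E.
    by apply/funext => n; rewrite integral_mkcond.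
  have mg := measurable_int _ intg.
  have [|||||_ _ //] := @dominated_convergence _ _ _ mu setT measurableT f_ (EFin \o g)
      (fun x => `|(g x)%:E|%E).
  - by move=> n; apply/measurable_restrict => //; rewrite setTI; exact: measurable_funTS.
  - by [].
  - apply: aeW => x _; apply: cvg_near_cst; near=> n.
    rewrite /f_ patchE mem_set//= in_itv/= -ler_norml.
    rewrite (@le_trans _ _ n%:R) ?ler_nat//.
    by near: n; exact: nbhs_infty_ger.
  - exact: integrable_abse.
  - apply: aeW => x n _; rewrite /f_ patchE; case: ifP => // _.
    by rewrite abse0 abse_ge0.
have lim2 : (\int[mu]_(x in `[(- n.+1%:R)%R, n.+1%:R]) (g x)%:E @[n --> \oo] --> 0)%E.
  (* For |x| >= 1, 1 + |x| <= 2 |x|, and exp (- y) <= 1 / y at y = x^2 / 2; the product of the two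
     bounds is of order 1 / |x|. *)
  have Fb (x : R) : 1 <= `|x| -> `|F x| <= 4 * C * normal_peak 1 * `|x|^-1.
    move=> x1; rewrite /F normrM [`|phi x|]ger0_norm ?normal_pdf_ge0// normal_pdf01E.
    have x0 : 0 < `|x| by apply: lt_le_trans x1.
    apply: (@le_trans _ _ (C * (1 + `|x|) * (normal_peak 1 * expR (- (x ^+ 2 / 2))))).
      by rewrite ler_wpM2r// mulr_ge0 ?normal_peak_ge0 ?expR_ge0.
    have -> : 4 * C * normal_peak 1 / `|x| = C * (2 * `|x|) * (normal_peak 1 * (x ^+ 2
        / 2)^-1).
      by rewrite -[x ^+ 2]real_normK ?num_real//; field; rewrite gt_eqF.
    have x20 : 0 < x ^+ 2 / 2 by rewrite divr_gt0// -real_normK ?num_real// exprn_gt0.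
    apply: ler_pM.
    + by rewrite mulr_ge0// addr_ge0.
    + by rewrite mulr_ge0 ?normal_peak_ge0 ?expR_ge0.
    + by rewrite ler_wpM2l//; lra.
    + rewrite ler_wpM2l ?normal_peak_ge0// expRN lef_pV2 ?posrE ?expR_gt0//.
      have := expR_ge1Dx (x ^+ 2 / 2); lra.
  under eq_fun do rewrite FTC.
  rewrite -(subee (_ : 0%E \is a fin_num))//.
  have Vn : (n.+1%:R^-1 : R) @[n --> \oo] --> (0 : R) by exact: cvg_harmonic.
  have cz (u : nat -> R) : (forall n, `|u n| = n.+1%:R) -> F (u n) @[n --> \oo] --> (0 : R).
    move=> un; apply/norm_cvg0P.
    apply: (@squeeze_cvgr _ _ _ _ (cst 0) (fun n => 4 * C * normal_peak 1 * n.+1%:R^-1)).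
    + apply: nearW => n /=; rewrite normr_ge0/= -(un n) Fb// un.
      by rewrite -[1]/(1%:R) ler_nat.
    + exact: cvg_cst.
    + by rewrite -(mulr0 (4 * C * normal_peak 1)); apply: cvgM => //; exact: cvg_cst.
  apply: cvgeB => //; (apply: cvg_EFin; first exact: nearW); apply: cz => n.
  + by rewrite ger0_norm.
  + by rewrite normrN ger0_norm.
have fA := integrable_fin_num measurableT (integrable_mul_normal_pdf int1).
have fB := integrable_fin_num measurableT (integrable_mul_normal_pdf int2).
have : (\int[mu]_x (g x)%:E = 0)%E by exact: cvg_unique lim1 lim2.
under eq_integral do rewrite EFinB.
rewrite integralB//; [|exact: integrable_mul_normal_pdf..].
move=> e; apply/esym; have /eqP := e; rewrite sube_eq//.
by rewrite add0e => /eqP.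
Unshelve. all: by end_near. Qed.

End gaussian_stein.

(** * The sigma-algebra on matrices generated by measurable boxes *)

Section matrix_boxes.
Context {R : realType} {n l : nat}.

(** Boxes are a pi-system on which independence of the entries gives the law of a random matrix
    directly, so two laws can be compared on them. *)
Definition mx_boxes : set (set 'M[R]_(n, l)) :=
  [set A | exists2 B : 'I_n -> 'I_l -> set R, (forall i j, measurable (B i j)) &
     A = [set M : 'M[R]_(n, l) | forall i j, B i j (M i j)]].

Definition box_mx := g_sigma_algebraType mx_boxes.

Lemma setI_closed_mx_boxes : setI_closed mx_boxes.
Proof.
move=> _ _ [B mB ->] [C mC ->]; exists (fun i j => B i j `&` C i j).
  by move=> i j; exact: measurableI.
apply/seteqP; split => M /=.
  by move=> [BM CM] i j; split; [exact: BM|exact: CM].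
by move=> BCM; split => i j; have [] := BCM i j.
Qed.

Lemma measurable_mx_entry i j :
  measurable_fun setT (fun M : box_mx => (M : 'M[R]_(n, l)) i j).
Proof.
move=> _ B mB; rewrite setTI; apply: sub_sigma_algebra.
exists (fun i' j' => if (i' == i) && (j' == j) then B else setT).
  by move=> i' j'; case: ifP.
apply/seteqP; split => M /=.
  by move=> BM i' j'; case: ifP => // /andP[/eqP -> /eqP ->].
by move=> /(_ i j); rewrite !eqxx.
Qed.

Lemma measurable_to_box_mx d (S : measurableType d) (F : S -> box_mx) :
  (forall i j, measurable_fun setT (fun s => (F s : 'M[R]_(n, l)) i j)) ->
  measurable_fun setT F.
Proof.
move=> mF; apply: (@measurability _ _ _ box_mx _ _ mx_boxes) => //.
move=> _ [_ [B mB ->] <-]; rewrite setTI.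
rewrite (_ : _ @^-1` _ = \bigcap_(i in setT) \bigcap_(j in setT) ((fun s => (F s :
    'M[R]_(n, l)) i j) @^-1` B i j)); last first.
  by apply/seteqP; split => s /= H i; [move=> _ j _; exact: H|move=> j; exact: H].
apply: fin_bigcap_measurable => // i _; apply: fin_bigcap_measurable => // j _.
by rewrite -[X in measurable X]setTI; apply: mF.
Qed.

(** A translation along [delta_mx i j], so that varying x is the same motion as in the directional
    derivatives [M + y *: delta_mx i j]. *)
Definition upd_mx (M : 'M[R]_(n, l)) i j (x : R) : 'M[R]_(n, l) :=
  M + (x - M i j) *: delta_mx i j.

Lemma upd_mxE M i j x i' j' :
  upd_mx M i j x i' j' = if (i' == i) && (j' == j) then x else M i' j'.
Proof.
rewrite /upd_mx !mxE; case: ifP => [/andP[/eqP -> /eqP ->]|_].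
  by rewrite mulr1 addrC subrK.
by rewrite mulr0 addr0.
Qed.

End matrix_boxes.
Arguments box_mx : clear implicits.

(** * Resampling one entry of a Gaussian matrix *)

Section resampling.
Context {dT : measure_display} {T : measurableType dT} {R : realType}.
Variable P : probability T R.
Context {n l : nat}.
Variable Omega : T -> 'M[R]_(n, l).
Hypothesis gOmega : gaussian_matrix P Omega.
Local Notation nu := (@normal_prob R 0 1).

Let mOmega : measurable_fun setT (Omega : T -> box_mx R n l).
Proof. by apply: measurable_to_box_mx => i j; case: gOmega. Qed.

Lemma measurable_upd_mx i j :
  measurable_fun setT (fun wx : T * measurableTypeR R => upd_mx (Omega wx.1) i j wx.2 :
      box_mx R n l).
Proof.
apply: measurable_to_box_mx => i' j'.
under eq_fun do rewrite upd_mxE.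
case: (_ && _); first exact: measurable_snd.
case: gOmega => mO _ _.
exact: (measurableT_comp (mO i' j') measurable_fst).
Qed.

Let box_event (J : {set 'I_n * 'I_l}) (B : 'I_n -> 'I_l -> set R) : set T :=
  \bigcap_(ij in [set` J]) ((fun w => Omega w ij.1 ij.2) @^-1` B ij.1 ij.2).

Let measurable_box_event J B : (forall i j, measurable (B i j)) ->
  measurable (box_event J B).
Proof.
move=> mB; apply: fin_bigcap_measurable => // ij _.
by rewrite -[X in measurable X]setTI; case: gOmega => mO _ _; apply: mO.
Qed.

Let prob_box_event J B : (forall i j, measurable (B i j)) ->
  P (box_event J B) = (\prod_(ij in J) nu (B ij.1 ij.2))%E.
Proof.
move=> mB; case: gOmega => mO lO indO.
rewrite /box_event (indO J (fun ij => B ij.1 ij.2) (fun ij => mB _ _)).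
by apply: eq_bigr => ij _; rewrite -(lO ij.1 ij.2).
Qed.

(* By independence both measures agree on boxes, which generate the sigma-algebra. *)
Lemma law_resample i j (A : set (box_mx R n l)) : measurable A ->
  pushforward P (Omega : T -> box_mx R n l) A =
  pushforward (P \x nu)%E (fun wx => upd_mx (Omega wx.1) i j wx.2 : box_mx R n l) A.
Proof.
pose m1 : {measure set (box_mx R n l) -> \bar R} :=
  measure_function_pushforward__canonical__measure_function_Measure P mOmega.
pose m2 : {measure set (box_mx R n l) -> \bar R} :=
  measure_function_pushforward__canonical__measure_function_Measure (P \x nu)%E
      (@measurable_upd_mx i j).
move=> mA; rewrite -[LHS]/(m1 A) -[RHS]/(m2 A).
have := @measure_unique _ R (box_mx R n l) (@mx_boxes R n l) (fun _ => setT) erefl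
    (@setI_closed_mx_boxes R n l) _ _ m1 m2.
apply=> //.
- by move=> _; exists (fun _ _ => setT) => //; apply/seteqP; split.
- exact: bigcup_const.
- move=> _ [B mB ->]; rewrite /m1 /m2 /= /pushforward.
  transitivity (P (box_event [set: 'I_n * 'I_l]%SET B)).
    congr (P _); apply/seteqP; split => w /= H => [[i' j'] _|i' j']; first exact: H.
    by apply: (H (i', j')); rewrite /= inE.
  rewrite prob_box_event// (bigD1 (i, j)) ?inE//=.
  (* The updated matrix lies in the box exactly when the entries of [Omega] other than (i, j) do and
     x lies in [B i j]: a product set. *)
  rewrite (_ : _ @^-1` _ = box_event [set~ (i, j)]%SET B `*` B i j); last first.
    apply/seteqP; split => -[w x] /=.
      move=> H; split => [[i' j']|]; last by have := H i j; rewrite upd_mxE !eqxx.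
      rewrite /= !inE xpair_eqE => /negbTE ij.
      by have := H i' j'; rewrite upd_mxE ij.
    move=> [H Bx] i' j'; rewrite upd_mxE; case: ifP => [/andP[/eqP -> /eqP ->]//|ij].
    by apply: (H (i', j')); rewrite /= !inE xpair_eqE ij.
  rewrite product_measure1E; [|exact: measurable_box_event|exact: mB].
  rewrite muleC; congr (_ * _)%E; apply: etrans (esym (prob_box_event _ mB)).
  by apply: eq_bigl => ij; rewrite !inE.
- by move=> _; rewrite /m1 /= /pushforward preimage_setT probability_setT ltry.
Qed.

(** Isolates entry (i, j) as an inner integral against the one-dimensional Gaussian, where
    [stein_normal_prob] applies. *)
Lemma expectation_resample i j (F : 'M[R]_(n, l) -> R) :
  measurable_fun setT (F : box_mx R n l -> R) ->
  P.-integrable setT (fun w => (F (Omega w))%:E) ->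
  (P \x nu)%E.-integrable setT (fun wx => (F (upd_mx (Omega wx.1) i j wx.2))%:E) /\
  (\int[P]_w (F (Omega w))%:E =
   \int[P]_w \int[nu]_x (F (upd_mx (Omega w) i j x))%:E)%E.
Proof.
move=> mF iF.
have mEF : measurable_fun setT (EFin \o (F : box_mx R n l -> R)) by exact/measurable_EFinP.
pose Up := fun wx : T * measurableTypeR R => upd_mx (Omega wx.1) i j wx.2 : box_mx R n l.
have mUp : measurable_fun setT Up := @measurable_upd_mx i j.
have iF2 : (P \x nu)%E.-integrable setT ((EFin \o F) \o Up).
  apply/integrableP; split; first exact: measurableT_comp.
  have /integrableP[_] := iF.
  congr (_ < _)%E.
  rewrite -[LHS](@ge0_integral_pushforward _ _ _ _ _ _ mOmega P setT (fun M => `|(F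
      M)%:E|%E))//; last exact: measurableT_comp.
  rewrite -[RHS](@ge0_integral_pushforward _ _ _ _ _ _ mUp (P \x nu)%E setT (fun M =>
      `|(F M)%:E|%E))//; last exact: measurableT_comp.
  by apply: eq_measure_integral => A mA _; exact: law_resample.
split => //.
rewrite (@integral12_prod_meas1 _ _ _ _ _ P nu (fun wx => (F (upd_mx (Omega wx.1) i j
    wx.2))%:E) iF2).
rewrite -[LHS](@integral_pushforward _ _ _ _ _ _ mOmega P setT (EFin \o F) mEF iF measurableT).
rewrite -[RHS](@integral_pushforward _ _ _ _ _ _ mUp (P \x nu)%E setT (EFin \o F) mEF
    iF2 measurableT).
by apply: eq_measure_integral => A mA _; exact: law_resample.
Qed.

End resampling.

(** * Integration by parts along one entry *)

Section gaussian_matrix_stein.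
Context {dT : measure_display} {T : measurableType dT} {R : realType}.
Variable P : probability T R.
Context {n l : nat}.
Variable Omega : T -> 'M[R]_(n, l).
Hypothesis gOmega : gaussian_matrix P Omega.
Implicit Types M : 'M[R]_(n, l).
Local Notation nu := (@normal_prob R 0 1).

(** The entrywise l1 norm: replacing one entry by x raises it by at most |x|, so linear growth in
    the matrix passes to linear growth in one entry. *)
Definition mx_norm1 (M : 'M[R]_(n, l)) : R := \sum_(ab : 'I_n * 'I_l) `|M ab.1 ab.2|.

Let sqr_sum (M : 'M[R]_(n, l)) : R := \sum_(ab : 'I_n * 'I_l) M ab.1 ab.2 ^+ 2.

Lemma mx_norm1_ge0 M : 0 <= mx_norm1 M.
Proof. by apply: sumr_ge0. Qed.

Let sqr_le M i j : M i j ^+ 2 <= sqr_sum M.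
Proof.
rewrite /sqr_sum (bigD1 (i, j))//= lerDl.
by apply: sumr_ge0 => ? _; exact: sqr_ge0.
Qed.

Let sqr_sum_ge0 M : 0 <= sqr_sum M.
Proof. by apply: sumr_ge0 => ? _; exact: sqr_ge0. Qed.

Lemma integrable_gaussian_sqr i j :
  P.-integrable setT (fun w => (Omega w i j ^+ 2)%:E).
Proof.
have [mO lO _] := gOmega.
apply/integrableP; split.
  by apply/measurable_EFinP; exact: measurable_funX.
under eq_integral do rewrite gee0_abs ?lee_fin ?sqr_ge0//.
pose f := fun x : R => (x ^+ 2)%:E.
have mf : measurable_fun setT f by apply/measurable_EFinP; exact: exprn_measurable.
have mOij : measurable_fun setT (fun w => Omega w i j : measurableTypeR R) := mO i j.
have := @ge0_integral_pushforward _ _ _ _ _ _ mOij P setT f measurableT mf.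
move=> <-; last by move=> x _; rewrite lee_fin sqr_ge0.
apply: le_lt_trans (normal_prob_sqr_lty : _ < +oo)%E.
rewrite le_eqVlt; apply/orP; left; apply/eqP.
pose m1 : {measure set (measurableTypeR R) -> \bar R} :=
  measure_function_pushforward__canonical__measure_function_Measure P mOij.
pose m2 : {measure set (measurableTypeR R) -> \bar R} := nu.
rewrite -[LHS]/(\int[m1]_x f x)%E -[RHS]/(\int[m2]_x f x)%E.
by apply: eq_measure_integral => A mA _; rewrite /m2/= -(lO i j).
Qed.

(** Second moments are all that is used of the entries. This fits fields of linear growth, since
    such a field times an entry is dominated by a sum of squares. *)
Lemma integrable_quadratic_growth (F : 'M[R]_(n, l) -> R) (C : R) :
  measurable_fun setT (F : box_mx R n l -> R) ->
  (forall M, `|F M| <= C * (1 + \sum_(ab : 'I_n * 'I_l) M ab.1 ab.2 ^+ 2)) ->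
  P.-integrable setT (fun w => (F (Omega w))%:E).
Proof.
move=> mF FC.
have mOmega : measurable_fun setT (Omega : T -> box_mx R n l).
  by apply: measurable_to_box_mx => i j; case: gOmega.
apply: (@le_integrable _ _ _ P _ measurableT _ (fun w =>
  C%:E * (1%:E + \sum_(ab : 'I_n * 'I_l) (Omega w ab.1 ab.2 ^+ 2)%:E))%E) => //=.
- by apply/measurable_EFinP; exact: (measurableT_comp mF mOmega).
- by move=> w _; rewrite sumEFin lee_fin (le_trans (FC _))// ler_norm.
- apply: integrableZl => //; apply: integrableD => //.
    exact: finite_measure_integrable_cst.
  by apply: integrable_sum => // ab _; exact: integrable_gaussian_sqr.
Qed.

Let N : R := (#|{: 'I_n * 'I_l}|)%:R.

Let entry_mul_norm1 M i j : `|M i j| * (1 + mx_norm1 M) <= (1 + N) * (1 + sqr_sum M).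
Proof.
have a1 : `|M i j| <= 1 + sqr_sum M.
  have := sqr_le M i j; rewrite -[M i j ^+ 2]real_normK ?num_real//.
  have := sqr_ge0 (`|M i j| - 1); nra.
rewrite mulrDr mulr1 mulrDl mul1r lerD// /mx_norm1 mulr_sumr.
apply: (@le_trans _ _ (\sum_(ab : 'I_n * 'I_l) (1 + sqr_sum M))); last first.
  by rewrite sumr_const /N mulr_natl.
apply: ler_sum => -[a b] _ /=.
have := sqr_le M i j; rewrite -[M i j ^+ 2]real_normK ?num_real//.
have := sqr_le M a b; rewrite -[M a b ^+ 2]real_normK ?num_real//.
have := sqr_ge0 (`|M i j| - `|M a b|); nra.
Qed.

Let norm1_sqr_sum M : 1 + mx_norm1 M <= (1 + N) * (1 + sqr_sum M).
Proof.
rewrite mulrDl mul1r lerD//; first by rewrite lerDl.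
apply: (@le_trans _ _ (\sum_(ab : 'I_n * 'I_l) (1 + sqr_sum M))); last first.
  by rewrite sumr_const /N mulr_natl.
apply: ler_sum => -[a b] _ /=.
have := sqr_le M a b; rewrite -[M a b ^+ 2]real_normK ?num_real//.
have := sqr_ge0 (`|M a b| - 1); nra.
Qed.

Lemma mx_norm1_upd M i j x : mx_norm1 (upd_mx M i j x) <= mx_norm1 M + `|x|.
Proof.
rewrite /mx_norm1 (bigD1 (i, j))//= upd_mxE !eqxx/= addrC lerD2r.
rewrite [leRHS](bigD1 (i, j))//= -[leLHS]add0r lerD//.
apply: ler_sum => -[a b] /=; rewrite xpair_eqE => /negbTE ab.
by rewrite upd_mxE ab.
Qed.

Variables (i : 'I_n) (j : 'I_l) (H H' : 'M[R]_(n, l) -> R) (C : R).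
Hypothesis mH : measurable_fun setT (H : box_mx R n l -> R).
Hypothesis mH' : measurable_fun setT (H' : box_mx R n l -> R).
Hypothesis dH : forall M, is_derive (0 : R) 1 (fun x => H (M + x *: delta_mx i j)) (H' M).
Hypothesis cH' : forall M, continuous_at (0 : R) (fun x : R => H' (M + x *: delta_mx i j)).
Hypothesis HC : forall M, `|H M| <= C * (1 + mx_norm1 M).
Hypothesis H'C : forall M, `|H' M| <= C * (1 + mx_norm1 M).

Let C0 : 0 <= C.
Proof.
have := le_trans (normr_ge0 _) (HC 0); rewrite /mx_norm1 big1 ?addr0 ?mulr1//.
by move=> ab _; rewrite mxE normr0.
Qed.

Lemma integrable_entry_mul : P.-integrable setT (fun w => (Omega w i j * H (Omega w))%:E).
Proof.
apply: (@integrable_quadratic_growth (fun M => M i j * H M) (C * (1 + N))).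
  by apply: measurable_funM => //; exact: measurable_mx_entry.
move=> M; rewrite normrM; apply: (le_trans (ler_wpM2l (normr_ge0 _) (HC M))).
by rewrite mulrCA -mulrA ler_wpM2l// entry_mul_norm1.
Qed.

Lemma integrable_linear_growth : P.-integrable setT (fun w => (H' (Omega w))%:E).
Proof.
apply: (@integrable_quadratic_growth H' (C * (1 + N))) => // M.
by apply: (le_trans (H'C M)); rewrite -mulrA ler_wpM2l.
Qed.

Lemma stein_entry :
  (\int[P]_w (Omega w i j * H (Omega w))%:E = \int[P]_w (H' (Omega w))%:E)%E.
Proof.
have [_ ->] := expectation_resample (F := fun M => M i j * H M) gOmega i j
  (measurable_funM (measurable_mx_entry i j) mH) integrable_entry_mul.
have [_ ->] := expectation_resample gOmega i j mH' integrable_linear_growth.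
apply: eq_integral => w _; set M := Omega w.
under eq_integral do rewrite upd_mxE !eqxx/=.
(* [dH] and [cH'] speak of the point 0 but of every base matrix; moving the base to [upd_mx M i j x]
   yields them at every x. *)
have updD x y : upd_mx M i j y = upd_mx M i j x + (y - x) *: delta_mx i j.
  by rewrite /upd_mx -addrA -scalerDl; congr (_ + _ *: _); ring.
pose h x := H (upd_mx M i j x); pose h' x := H' (upd_mx M i j x).
have bound F : (forall M, `|F M| <= C * (1 + mx_norm1 M)) ->
    forall x, `|F (upd_mx M i j x)| <= C * (1 + mx_norm1 M) * (1 + `|x|).
  move=> FC x; apply: (le_trans (FC _)); rewrite -mulrA ler_wpM2l//.
  have := mx_norm1_upd M i j x; have := mx_norm1_ge0 M; have := normr_ge0 x.
  nra.
apply: (@stein_normal_prob R h h' (C * (1 + mx_norm1 M))).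
- move=> x.
  have -> : h = (fun y => H (upd_mx M i j x + y *: delta_mx i j)) \o (fun y : R => y - x).
    by apply/funext => y /=; rewrite /h (updD x y).
  have d1 : is_derive x 1 (fun y : R => y - x) 1.
    by apply: is_derive_eq; rewrite subr0.
  have d2 := dH (upd_mx M i j x); rewrite -[X in is_derive X](subrr x) in d2.
  by have := @is_derive1_comp _ (fun y => H (upd_mx M i j x + y *: delta_mx i j)) (fun
      y => y - x) x _ _ d2 d1; rewrite mulr1.
- move=> x.
  have -> : h' = (fun y => H' (upd_mx M i j x + y *: delta_mx i j)) \o (fun y : R => y - x).
    by apply/funext => y /=; rewrite /h' (updD x y).
  apply: continuous_comp; first by apply: cvgB; [exact: cvg_id|exact: cvg_cst].
  by rewrite subrr; exact: cH'.
- exact: bound.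
- exact: bound.
Qed.

End gaussian_matrix_stein.

(** * Calculus of matrix-valued functions *)

Section matrix_functions.
Context {R : realType}.

Definition measurable_mx d (S : measurableType d) a b (F : S -> 'M[R]_(a, b)) :=
  forall i j, measurable_fun setT (fun s => F s i j).

Lemma measurable_mx_cst d (S : measurableType d) a b (A : 'M[R]_(a, b)) :
  measurable_mx (fun _ : S => A).
Proof. by move=> i j; exact: measurable_cst. Qed.

Lemma measurable_mxD d (S : measurableType d) a b (F G : S -> 'M[R]_(a, b)) :
  measurable_mx F -> measurable_mx G -> measurable_mx (fun s => F s + G s).
Proof.
move=> mF mG i j; under eq_fun do rewrite mxE.
exact: measurable_funD.
Qed.

Lemma measurable_mxB d (S : measurableType d) a b (F G : S -> 'M[R]_(a, b)) :
  measurable_mx F -> measurable_mx G -> measurable_mx (fun s => F s - G s).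
Proof.
move=> mF mG i j; under eq_fun do rewrite !mxE.
exact: measurable_funB.
Qed.

Lemma measurable_mxT d (S : measurableType d) a b (F : S -> 'M[R]_(a, b)) :
  measurable_mx F -> measurable_mx (fun s => (F s)^T).
Proof. by move=> mF i j; under eq_fun do rewrite mxE; exact: mF. Qed.

Lemma measurable_mxM d (S : measurableType d) a b c (F : S -> 'M[R]_(a, b))
    (G : S -> 'M[R]_(b, c)) :
  measurable_mx F -> measurable_mx G -> measurable_mx (fun s => F s *m G s).
Proof.
move=> mF mG i j; under eq_fun do rewrite mxE.
by apply: measurable_sum => h; exact: measurable_funM.
Qed.

Lemma measurable_fun_det d (S : measurableType d) a (F : S -> 'M[R]_a) :
  measurable_mx F -> measurable_fun setT (fun s => \det (F s)).
Proof.
move=> mF; rewrite /determinant.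
apply: measurable_sum => s; apply: measurable_funM => //.
by apply: measurable_prod => i _; exact: mF.
Qed.

(** Reduces measurability of inversion to that of a real power; at 0 both sides are 0. *)
Lemma invr_powR (x : R) : x^-1 = x * (x ^+ 2) `^ (-1).
Proof.
rewrite powR_inv1 ?sqr_ge0//; have [->|x0] := eqVneq x 0.
  by rewrite invr0 mul0r.
by field.
Qed.

Lemma measurable_mx_inv d (S : measurableType d) a (F : S -> 'M[R]_a) :
  (forall s, F s \in unitmx) ->
  measurable_mx F -> measurable_mx (fun s => invmx (F s)).
Proof.
move=> uF mF i j; under eq_fun do rewrite /invmx uF !mxE.
apply: measurable_funM.
  under eq_fun do rewrite invr_powR; apply: measurable_funM.
    exact: measurable_fun_det.
  apply: (measurableT_comp (measurable_powR _)); apply: measurable_funX.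
  exact: measurable_fun_det.
rewrite /cofactor; apply: measurable_funM => //.
apply: measurable_fun_det => i' j'.
by under eq_fun do rewrite !mxE; exact: mF.
Qed.

Lemma measurable_fun_tr d (S : measurableType d) a (F : S -> 'M[R]_a) :
  measurable_mx F -> measurable_fun setT (fun s => \tr (F s)).
Proof. by move=> mF; rewrite /mxtrace; apply: measurable_sum => i; exact: mF. Qed.

Definition bounded_mx (S : Type) a b (F : S -> 'M[R]_(a, b)) :=
  exists C : R, forall s i j, `|F s i j| <= C.

Lemma bounded_mx_cst (S : Type) a b (A : 'M[R]_(a, b)) : bounded_mx (fun _ : S => A).
Proof.
exists (\sum_i \sum_j `|A i j|) => _ i j.
rewrite (bigD1 i)//= (bigD1 j)//= -addrA lerDl addr_ge0//.
  by apply: sumr_ge0.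
by apply: sumr_ge0 => ? _; apply: sumr_ge0.
Qed.

Lemma bounded_mxD (S : Type) a b (F G : S -> 'M[R]_(a, b)) :
  bounded_mx F -> bounded_mx G -> bounded_mx (fun s => F s + G s).
Proof.
move=> [C FC] [D GD]; exists (C + D) => s i j; rewrite mxE.
by rewrite (le_trans (ler_normD _ _))// lerD.
Qed.

Lemma bounded_mxB (S : Type) a b (F G : S -> 'M[R]_(a, b)) :
  bounded_mx F -> bounded_mx G -> bounded_mx (fun s => F s - G s).
Proof.
move=> [C FC] [D GD]; exists (C + D) => s i j; rewrite !mxE.
by rewrite (le_trans (ler_normB _ _))// lerD.
Qed.

Lemma bounded_mxT (S : Type) a b (F : S -> 'M[R]_(a, b)) :
  bounded_mx F -> bounded_mx (fun s => (F s)^T).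
Proof. by move=> [C FC]; exists C => s i j; rewrite mxE. Qed.

Lemma bounded_mxM (S : Type) a b c (F : S -> 'M[R]_(a, b)) (G : S -> 'M[R]_(b, c)) :
  bounded_mx F -> bounded_mx G -> bounded_mx (fun s => F s *m G s).
Proof.
move=> [C FC] [D GD]; exists (\sum_(h < b) C * D) => s i j; rewrite mxE.
apply: (le_trans (ler_norm_sum _ _ _)); apply: ler_sum => h _.
by rewrite normrM ler_pM.
Qed.

Definition is_derive_mx a b (F : R -> 'M[R]_(a, b)) (x : R) (F' : 'M[R]_(a, b)) :=
  forall i j, is_derive x 1 (fun y : R => F y i j) (F' i j).

Lemma is_derive_mx_cst a b (A : 'M[R]_(a, b)) x : is_derive_mx (fun _ => A) x 0.
Proof. by move=> i j; rewrite mxE; exact: is_derive_cst. Qed.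

Lemma is_derive_mx_line a b (A D : 'M[R]_(a, b)) x :
  is_derive_mx (fun y => A + y *: D) x D.
Proof.
move=> i j.
rewrite [X in is_derive _ _ X](_ : _ = cst (A i j) + D i j \*: (id : R -> R)); last first.
  by apply/funext => y; rewrite !mxE fctE /= mulrC.
by apply: is_derive_eq; rewrite add0r /GRing.scale/= mulr1.
Qed.

Lemma is_derive_mxD a b (F G : R -> 'M[R]_(a, b)) x F' G' :
  is_derive_mx F x F' -> is_derive_mx G x G' ->
  is_derive_mx (fun y => F y + G y) x (F' + G').
Proof.
move=> dF dG i j; rewrite mxE.
rewrite [X in is_derive _ _ X](_ : _ = (fun y => F y i j) + (fun y => G y i j)); last first.
  by apply/funext => y; rewrite !mxE.
exact: is_deriveD.
Qed.

Lemma is_derive_mxB a b (F G : R -> 'M[R]_(a, b)) x F' G' :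
  is_derive_mx F x F' -> is_derive_mx G x G' ->
  is_derive_mx (fun y => F y - G y) x (F' - G').
Proof.
move=> dF dG i j; rewrite !mxE.
rewrite [X in is_derive _ _ X](_ : _ = (fun y => F y i j) - (fun y => G y i j)); last first.
  by apply/funext => y; rewrite !mxE.
exact: is_deriveB.
Qed.

Lemma is_derive_mxT a b (F : R -> 'M[R]_(a, b)) x F' :
  is_derive_mx F x F' -> is_derive_mx (fun y => (F y)^T) x F'^T.
Proof. by move=> dF i j; under eq_fun do rewrite mxE; rewrite mxE; exact: dF. Qed.

Lemma is_derive_mxM a b c (F : R -> 'M[R]_(a, b)) (G : R -> 'M[R]_(b, c)) x F' G' :
  is_derive_mx F x F' -> is_derive_mx G x G' ->
  is_derive_mx (fun y => F y *m G y) x (F' *m G x + F x *m G').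
Proof.
move=> dF dG i j.
rewrite [X in is_derive _ _ X](_ : _ = \sum_(h < b) (fun y => F y i h * G y h j)); last first.
  by apply/funext => y; rewrite !mxE fct_sumE.
rewrite !mxE -big_split/=; apply: is_derive_sum => h.
rewrite [X in is_derive _ _ X](_ : _ = (fun y => F y i h) * (fun y => G y h j))//.
have d1 := dF i h; have d2 := dG h j.
apply: is_derive_eq; rewrite /GRing.scale/=; ring.
Qed.

Lemma derivable_bigprod (I : Type) (r : seq I) (f : I -> R -> R) (x : R) :
  (forall i, derivable (f i) x 1) -> derivable (fun y => \prod_(i <- r) f i y) x 1.
Proof.
move=> df; elim: r => [|i r IH].
  by under eq_fun do rewrite big_nil; exact: derivable_cst.
rewrite [X in derivable X](_ : _ = f i * (fun y => \prod_(j <- r) f j y)).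
  exact: (derivableM (df i) IH).
by apply/funext => y; rewrite big_cons fctE.
Qed.

Lemma derivable_bigsum (I : Type) (r : seq I) (f : I -> R -> R) (x : R) :
  (forall i, derivable (f i) x 1) -> derivable (fun y => \sum_(i <- r) f i y) x 1.
Proof.
move=> df; elim: r => [|i r IH].
  by under eq_fun do rewrite big_nil; exact: derivable_cst.
rewrite [X in derivable X](_ : _ = f i + (fun y => \sum_(j <- r) f j y)).
  exact: (derivableD (df i) IH).
by apply/funext => y; rewrite big_cons fctE.
Qed.

Lemma derivable_det a (F : R -> 'M[R]_a) (x : R) :
  (forall i j, derivable (fun y => F y i j) x 1) ->
  derivable (fun y => \det (F y)) x 1.
Proof.
move=> dF; rewrite /determinant; apply: derivable_bigsum => s.
rewrite [X in derivable X](_ : _ = cst ((-1) ^+ (odd_perm s)) * (fun y => \prod_i F y i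
    (s i)))//.
apply: derivableM; first exact: derivable_cst.
exact: derivable_bigprod.
Qed.

(** Differentiability comes from the cofactor formula; the value of the derivative then follows by
    differentiating invmx (F y) F y = 1. *)
Lemma is_derive_mx_inv a (F : R -> 'M[R]_a) x F' :
  (forall y, F y \in unitmx) -> is_derive_mx F x F' ->
  is_derive_mx (fun y => invmx (F y)) x (- (invmx (F x) *m F' *m invmx (F x))).
Proof.
move=> uF dF.
have [W' dW] : exists W', is_derive_mx (fun y => invmx (F y)) x W'.
  have dI i j : derivable (fun y => invmx (F y) i j) x 1.
    under eq_fun do rewrite /invmx uF !mxE.
    apply: derivableM.
      apply: derivableV; first by rewrite -unitfE -unitmxE.
      by apply: derivable_det => i' j'; case: (dF i' j').
    rewrite /cofactor; apply: derivableM; first exact: derivable_cst.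
    apply: derivable_det => i' j'.
    by under eq_fun do rewrite !mxE; case: (dF (lift j i') (lift i j')).
  exists (\matrix_(i, j) 'D_1 (fun y => invmx (F y) i j) x) => i j.
  by rewrite mxE; exact: derivableP.
have := is_derive_mxM dW dF.
under [X in is_derive_mx X]eq_fun do rewrite mulVmx//.
move=> d1.
have E : W' *m F x + invmx (F x) *m F' = 0.
  apply/matrixP => i j.
  by rewrite -(@derive_val _ _ _ _ _ _ _ (d1 i j)) -(@derive_val _ _ _ _ _ _ _
      (is_derive_mx_cst 1%:M x i j)).
suff -> : - (invmx (F x) *m F' *m invmx (F x)) = W' by [].
move/eqP : E; rewrite addr_eq0 => /eqP E.
by rewrite -mulNmx -E -mulmxA mulmxV// mulmx1.
Qed.

Lemma is_derive_mx_continuous a b (F : R -> 'M[R]_(a, b)) x F' i j :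
  is_derive_mx F x F' -> continuous_at x (fun y => F y i j).
Proof.
by move=> /(_ i j) dF; apply/differentiable_continuous/derivable1_diffP; case: dF.
Qed.

End matrix_functions.

(** * The squared Frobenius norm as a trace *)

Section square_norm.
Context {R : realType}.

Definition sqnorm a b (M : 'M[R]_(a, b)) : R := \tr (M^T *m M).

Lemma sqnormE a b (M : 'M[R]_(a, b)) : sqnorm M = \sum_i \sum_j M i j ^+ 2.
Proof.
rewrite /sqnorm /mxtrace exchange_big; apply: eq_bigr => j _.
by rewrite mxE; apply: eq_bigr => i _; rewrite mxE expr2.
Qed.

Lemma sqnorm_ge0 a b (M : 'M[R]_(a, b)) : 0 <= sqnorm M.
Proof.
by rewrite sqnormE; apply: sumr_ge0 => i _; apply: sumr_ge0 => j _; exact: sqr_ge0.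
Qed.

Lemma sqnorm_eq0 a b (M : 'M[R]_(a, b)) : sqnorm M = 0 -> M = 0.
Proof.
move=> /eqP; rewrite sqnormE psumr_eq0; last first.
  by move=> i _; apply: sumr_ge0 => j _; exact: sqr_ge0.
move=> /allP H; apply/matrixP => i j; rewrite mxE; apply/eqP; rewrite -sqrf_eq0.
have := H i (mem_index_enum _); rewrite psumr_eq0; last by move=> ? _; exact: sqr_ge0.
by move=> /allP; apply; exact: mem_index_enum.
Qed.

Lemma sqnorm_frobenius a b (M : 'M[R]_(a, b)) : frobenius_norm M ^+ 2 = sqnorm M.
Proof. by rewrite sqnormE sqr_sqrtr// -sqnormE sqnorm_ge0. Qed.

Lemma sqnormT a b (M : 'M[R]_(a, b)) : sqnorm M^T = sqnorm M.
Proof. by rewrite /sqnorm trmxK mxtrace_mulC. Qed.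

Lemma sqnormZ a b (c : R) (M : 'M[R]_(a, b)) : sqnorm (c *: M) = c ^+ 2 * sqnorm M.
Proof. rewrite /sqnorm; have -> : (c *: M)^T = c *: M^T by rewrite linearZ.
by rewrite -scalemxAl -scalemxAr scalerA mxtraceZ expr2. Qed.

Lemma sqnormD_orth a b (M N : 'M[R]_(a, b)) : \tr (M^T *m N) = 0 ->
  sqnorm (M + N) = sqnorm M + sqnorm N.
Proof.
move=> MN; rewrite /sqnorm; have -> : (M + N)^T = M^T + N^T by rewrite linearD.
rewrite mulmxDl !mulmxDr !mxtraceD MN addr0.
by rewrite -[N^T *m M]trmxK mxtrace_tr trmx_mul trmxK MN add0r.
Qed.

End square_norm.

(** * The regularized pseudoinverse *)

Section ridge.
Context {R : realType} {q l : nat}.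
Variables (e : R) (e0 : 0 < e).
Implicit Types G : 'M[R]_(q, l).

(* [ridge_pinv G] is a smooth, bounded substitute for the pseudoinverse of [G],
   recovered in the limit [e -> 0]. *)
Definition ridge_gram G : 'M[R]_q := G *m G^T + e%:M.
Definition ridge_inv G : 'M[R]_q := invmx (ridge_gram G).
Definition ridge_pinv G : 'M[R]_(l, q) := G^T *m ridge_inv G.

(** Positive definiteness: a row u in the kernel satisfies ||u G||^2 + e ||u||^2 = 0. *)
Lemma ridge_gram_unit G : ridge_gram G \in unitmx.
Proof.
rewrite -row_free_unit -kermx_eq0; apply/eqP/row_matrixP => i; rewrite row0.
set u := row i _.
have uN : u *m ridge_gram G = 0 by rewrite -row_mul mulmx_ker row0.
have : sqnorm (u *m G)^T + e * sqnorm u^T = 0.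
  rewrite /sqnorm !trmxK trmx_mul !mulmxA -mxtraceZ -mxtraceD.
  rewrite scalemxAl -mul_mx_scalar -[u *m G *m _]mulmxA -mulmxDl -mulmxDr.
  by rewrite uN mul0mx mxtrace0.
move=> /eqP; rewrite paddr_eq0 ?sqnorm_ge0// ?mulr_ge0 ?sqnorm_ge0 ?ltW//.
rewrite mulf_eq0 (gt_eqF e0)/= => /andP[_ /eqP /sqnorm_eq0 u0].
by rewrite -[u]trmxK u0 trmx0.
Qed.

Lemma trmx_ridge_gram G : (ridge_gram G)^T = ridge_gram G.
Proof. by rewrite /ridge_gram linearD/= trmx_mul trmxK tr_scalar_mx. Qed.

Lemma trmx_ridge_inv G : (ridge_inv G)^T = ridge_inv G.
Proof. by rewrite /ridge_inv trmx_inv trmx_ridge_gram. Qed.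

Lemma trmx_ridge_pinv G : (ridge_pinv G)^T = ridge_inv G *m G.
Proof. by rewrite /ridge_pinv trmx_mul trmxK trmx_ridge_inv. Qed.

(** The defect of the right inverse; it is the source of the O(e) term in the residual bound. *)
Lemma mul_ridge_pinv G : G *m ridge_pinv G = 1%:M - e *: ridge_inv G.
Proof.
rewrite /ridge_pinv mulmxA; apply/eqP; rewrite eq_sym subr_eq.
by rewrite -mul_scalar_mx -mulmxDl mulmxV// ridge_gram_unit.
Qed.

(** Expands W = W (G G^T + e) W. Both summands are positive semidefinite, so each is controlled by
    W, in trace and on the diagonal. *)
Lemma ridge_invE G : ridge_inv G =
  (ridge_pinv G)^T *m ridge_pinv G + e *: ((ridge_inv G)^T *m ridge_inv G).
Proof.
rewrite trmx_ridge_pinv -mulmxA mul_ridge_pinv mulmxBr mulmx1 -scalemxAr.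
by rewrite trmx_ridge_inv subrK.
Qed.

(** A substitute for idempotence: K G exceeds its square by the positive semidefinite e K K^T, which
    bounds the entries of K G by 1 whatever e and G are. *)
Lemma ridge_projE G : ridge_pinv G *m G =
  (ridge_pinv G *m G)^T *m (ridge_pinv G *m G) + e *: (ridge_pinv G *m (ridge_pinv G)^T).
Proof.
have PT : (ridge_pinv G *m G)^T = ridge_pinv G *m G.
  by rewrite trmx_mul trmx_ridge_pinv mulmxA.
rewrite PT -mulmxA (mulmxA G) mul_ridge_pinv mulmxBl mulmxBr mul1mx.
by rewrite trmx_ridge_pinv -scalemxAl -scalemxAr subrK.
Qed.

Lemma tr_ridge_inv G :
  \tr (ridge_inv G) = sqnorm (ridge_pinv G) + e * sqnorm (ridge_inv G).
Proof.
by rewrite {1}ridge_invE mxtraceD mxtraceZ.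
Qed.

Lemma tr_ridge_inv_ge0 G : 0 <= \tr (ridge_inv G).
Proof.
by rewrite tr_ridge_inv addr_ge0 ?sqnorm_ge0// mulr_ge0 ?sqnorm_ge0// ltW.
Qed.

Lemma sqnorm_ridge_pinv_le G : sqnorm (ridge_pinv G) <= \tr (ridge_inv G).
Proof. by rewrite tr_ridge_inv lerDl mulr_ge0 ?sqnorm_ge0// ltW. Qed.

Lemma sqnorm_ridge_inv_le G : e * sqnorm (ridge_inv G) <= \tr (ridge_inv G).
Proof. by rewrite tr_ridge_inv lerDr sqnorm_ge0. Qed.

Lemma tr_ridge_proj G : \tr (ridge_pinv G *m G) = q%:R - e * \tr (ridge_inv G).
Proof. by rewrite mxtrace_mulC mul_ridge_pinv linearB/= mxtraceZ mxtrace1. Qed.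

Let diagE a b (M : 'M[R]_(a, b)) j : (M^T *m M) j j = \sum_i M i j ^+ 2.
Proof. by rewrite mxE; apply: eq_bigr => i _; rewrite mxE expr2. Qed.

Let sqr_le_sum a b (M : 'M[R]_(a, b)) i j : M i j ^+ 2 <= (M^T *m M) j j.
Proof.
rewrite diagE (bigD1 i)//= lerDl; apply: sumr_ge0 => ? _; exact: sqr_ge0.
Qed.

Let diag_ge0 a b (M : 'M[R]_(a, b)) j : 0 <= (M^T *m M) j j.
Proof. by rewrite diagE; apply: sumr_ge0 => ? _; exact: sqr_ge0. Qed.

Let ridge_inv_diag G a : (ridge_inv G) a a =
  ((ridge_pinv G)^T *m ridge_pinv G) a a + e * ((ridge_inv G)^T *m ridge_inv G) a a.
Proof. by rewrite {1}ridge_invE mxE [X in _ + X]mxE. Qed.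

(** The decomposition of W on the diagonal gives W_aa >= e W_aa^2. *)
Lemma ridge_inv_diag_le G a : (ridge_inv G) a a <= e^-1.
Proof.
have [//|W0] := leP ((ridge_inv G) a a) 0; first by move=> /le_trans; apply;
    rewrite invr_ge0 ltW.
rewrite -[leRHS]mul1r ler_pdivlMr// -(ler_pM2l W0) mulr1 [in leRHS]ridge_inv_diag.
rewrite mulrA mulrC; apply: ler_wpDl; first exact: diag_ge0.
by rewrite ler_pM2l// -expr2 sqr_le_sum.
Qed.

Lemma ridge_inv_le G a b : `|ridge_inv G a b| <= e^-1.
Proof.
have e10 : 0 <= e^-1 by rewrite invr_ge0 ltW.
rewrite -(ger0_norm e10) -ler_sqr ?nnegrE// !real_normK ?num_real//.
have H : e * ridge_inv G a b ^+ 2 <= e^-1.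
  apply: le_trans (ridge_inv_diag_le G b); rewrite ridge_inv_diag.
  by apply: ler_wpDl; [exact: diag_ge0|rewrite ler_pM2l// sqr_le_sum].
by rewrite -(ler_pM2l e0) (le_trans H)// expr2 mulrA divff ?gt_eqF// mul1r.
Qed.

Lemma ridge_pinv_le G a b : `|ridge_pinv G a b| <= 1 + e^-1.
Proof.
have H : ridge_pinv G a b ^+ 2 <= e^-1.
  apply: le_trans (ridge_inv_diag_le G b); rewrite ridge_inv_diag.
  apply: ler_wpDr; last exact: sqr_le_sum.
  by rewrite mulr_ge0 ?diag_ge0 ?ltW.
have := sqr_ge0 (`|ridge_pinv G a b| - 1).
rewrite -[X in X <= _]real_normK ?num_real// in H; nra.
Qed.

Lemma ridge_proj_le G a b : `|(ridge_pinv G *m G) a b| <= 1.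
Proof.
set Pm := ridge_pinv G *m G.
have D c : Pm c c = (Pm^T *m Pm) c c + e * ((ridge_pinv G)^T^T *m (ridge_pinv G)^T) c c.
  by rewrite {1}/Pm ridge_projE trmxK -/Pm mxE [X in _ + X]mxE.
have P1 c : Pm c c <= 1.
  have [|P0] := leP (Pm c c) 0; first by move=> /le_trans; apply.
  rewrite -(ler_pM2l P0) mulr1 [in leRHS]D -expr2.
  apply: ler_wpDr; last exact: sqr_le_sum.
  by rewrite mulr_ge0 ?diag_ge0 ?ltW.
rewrite -(ler_sqr (normr_ge0 _))// ?nnegrE// real_normK ?num_real// expr1n.
apply: le_trans (P1 b); rewrite D; apply: ler_wpDr; last exact: sqr_le_sum.
by rewrite mulr_ge0 ?diag_ge0 ?ltW.
Qed.

End ridge.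

(** * Integration by parts for Gaussian matrices *)

Section stein_field.
Context {dT : measure_display} {T : measurableType dT} {R : realType}.
Variable P : probability T R.
Context {n l : nat}.
Variable Omega : T -> 'M[R]_(n, l).
Hypothesis gOmega : gaussian_matrix P Omega.

Definition growth_mx a b (F : 'M[R]_(n, l) -> 'M[R]_(a, b)) :=
  exists C : R, forall M i j, `|F M i j| <= C * (1 + mx_norm1 M).

Lemma growth_mx_id : growth_mx id.
Proof.
exists 1 => M i j; rewrite mul1r /mx_norm1 (bigD1 (i, j))//=.
by rewrite addrCA lerDl addr_ge0// sumr_ge0.
Qed.

Lemma growth_mx_bounded a b (F : 'M[R]_(n, l) -> 'M[R]_(a, b)) :
  bounded_mx F -> growth_mx F.
Proof.
move=> [C FC]; exists C => M i j; apply: (le_trans (FC M i j)).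
by rewrite mulrDr mulr1 lerDl mulr_ge0 ?mx_norm1_ge0// (le_trans _ (FC M i j)).
Qed.

Lemma growth_mxD a b (F G : 'M[R]_(n, l) -> 'M[R]_(a, b)) :
  growth_mx F -> growth_mx G -> growth_mx (fun M => F M + G M).
Proof.
move=> [C FC] [D GD]; exists (C + D) => M i j; rewrite mxE mulrDl.
by rewrite (le_trans (ler_normD _ _))// lerD.
Qed.

Lemma growth_mxMl a b c (F : 'M[R]_(n, l) -> 'M[R]_(a, b)) (G : 'M[R]_(n, l) -> 'M[R]_(b, c)) :
  bounded_mx F -> growth_mx G -> growth_mx (fun M => F M *m G M).
Proof.
move=> [C FC] [D GD]; exists (\sum_(h < b) C * D) => M i j; rewrite mxE.
rewrite (le_trans (ler_norm_sum _ _ _))// mulr_suml; apply: ler_sum => h _.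
by rewrite normrM -mulrA ler_pM.
Qed.

Lemma growth_mxMr a b c (F : 'M[R]_(n, l) -> 'M[R]_(a, b)) (G : 'M[R]_(n, l) -> 'M[R]_(b, c)) :
  growth_mx F -> bounded_mx G -> growth_mx (fun M => F M *m G M).
Proof.
move=> [C FC] [D GD]; exists (\sum_(h < b) C * D) => M i j; rewrite mxE.
rewrite (le_trans (ler_norm_sum _ _ _))// mulr_suml; apply: ler_sum => h _.
by rewrite normrM mulrAC ler_pM.
Qed.

(* [H] is a vector field on matrices and [dH i j] its matrix of partial
   derivatives along the entry [(i, j)]. *)
Lemma stein_field (H : 'M[R]_(n, l) -> 'M[R]_(n, l))
    (dH : 'I_n -> 'I_l -> 'M[R]_(n, l) -> 'M[R]_(n, l)) :
  measurable_mx (H : box_mx R n l -> 'M[R]_(n, l)) ->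
  (forall i j, measurable_mx (dH i j : box_mx R n l -> 'M[R]_(n, l))) ->
  (forall i j M, is_derive_mx (fun y => H (M + y *: delta_mx i j)) 0 (dH i j M)) ->
  (forall i j M, exists D, is_derive_mx (fun y => dH i j (M + y *: delta_mx i j)) 0 D) ->
  growth_mx H -> (forall i j, growth_mx (dH i j)) ->
  [/\ P.-integrable setT (fun w => (\sum_(ij : 'I_n * 'I_l)
        Omega w ij.1 ij.2 * H (Omega w) ij.1 ij.2)%:E),
      P.-integrable setT (fun w => (\sum_(ij : 'I_n * 'I_l)
        dH ij.1 ij.2 (Omega w) ij.1 ij.2)%:E) &
      (\int[P]_w (\sum_(ij : 'I_n * 'I_l) Omega w ij.1 ij.2 * H (Omega w) ij.1 ij.2)%:E =
      \int[P]_w (\sum_(ij : 'I_n * 'I_l) dH ij.1 ij.2 (Omega w) ij.1 ij.2)%:E)%E].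
Proof.
move=> mH mdH HdH cdH gH gdH.
have wl i j : exists2 C : R, (forall M, `|H M i j| <= C * (1 + mx_norm1 M)) &
    (forall M, `|dH i j M i j| <= C * (1 + mx_norm1 M)).
  have [C HC] := gH; have [D dHD] := gdH i j; exists (Num.max C D) => M.
    by rewrite (le_trans (HC M i j))// ler_wpM2r ?addr_ge0 ?mx_norm1_ge0// le_max lexx.
  by rewrite (le_trans (dHD M i j))// ler_wpM2r ?addr_ge0 ?mx_norm1_ge0// le_max lexx orbT.
have i1 (ij : 'I_n * 'I_l) : P.-integrable setT (fun w => (Omega w ij.1 ij.2 * H (Omega
    w) ij.1 ij.2)%:E).
  have [C HC _] := wl ij.1 ij.2.
  exact: (integrable_entry_mul gOmega (H := fun M => H M ij.1 ij.2) ij.1 ij.2 (mH _ _) HC).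
have i2 (ij : 'I_n * 'I_l) : P.-integrable setT (fun w => (dH ij.1 ij.2 (Omega w) ij.1
    ij.2)%:E).
  have [C HC dHC] := wl ij.1 ij.2.
  exact: (integrable_linear_growth gOmega (H' := fun M => dH ij.1 ij.2 M ij.1 ij.2)
      (mdH _ _ _ _) HC dHC).
split.
- under eq_fun do rewrite -sumEFin; exact: integrable_sum.
- under eq_fun do rewrite -sumEFin; exact: integrable_sum.
under eq_integral do rewrite -sumEFin.
under [RHS]eq_integral do rewrite -sumEFin.
rewrite !integral_sum//; apply: eq_bigr => -[i j] _ /=.
have [C HC dHC] := wl i j.
apply: (@stein_entry _ _ _ _ _ _ _ gOmega i j (fun M => H M i j) (fun M => dH i j M i
    j) C) => //.
- exact: mdH.
- by move=> M; exact: HdH.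
- by move=> M; have [D dD] := cdH i j M; exact: is_derive_mx_continuous dD.
Qed.

End stein_field.

(** * Sums of partial derivatives as traces *)

Section delta_identities.
Context {R : realType} {n l : nat}.

(** Partial derivatives of the fields below are sums of terms X E Y and X E^T Y with E =
    [delta_mx i j]. Summed over (i, j), the first kind gives tr X tr Y by [sum_pair_diag], the
    second tr (X^T Y) by [sum_pair_trace]. *)
Lemma delta_sandwich (X : 'M[R]_n) (Y : 'M[R]_l) i j :
  (X *m delta_mx i j *m Y) i j = X i i * Y j j.
Proof.
rewrite mxE (bigD1 j)//= big1 ?addr0 => [|h hj].
  rewrite mxE (bigD1 i)//= big1 ?addr0 => [|h hi]; first by rewrite mxE !eqxx mulr1.
  by rewrite mxE (negbTE hi) mulr0.
rewrite mxE big1 ?mul0r// => a _.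
by rewrite mxE (negbTE hj) andbF mulr0.
Qed.

Lemma delta_sandwichT (X Y : 'M[R]_(n, l)) i j :
  (X *m (delta_mx i j)^T *m Y) i j = X i j * Y i j.
Proof.
rewrite trmx_delta mxE (bigD1 i)//= big1 ?addr0 => [|h hi].
  rewrite mxE (bigD1 j)//= big1 ?addr0 => [|h hj]; first by rewrite mxE !eqxx mulr1.
  by rewrite mxE (negbTE hj) mulr0.
rewrite mxE big1 ?mul0r// => a _.
by rewrite mxE (negbTE hi) andbF mulr0.
Qed.

Lemma sum_pair_trace (X Y : 'M[R]_(n, l)) :
  \sum_(ij : 'I_n * 'I_l) X ij.1 ij.2 * Y ij.1 ij.2 = \tr (X^T *m Y).
Proof.
rewrite -(pair_bigA _ (fun i j => X i j * Y i j))/= exchange_big/=.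
by apply: eq_bigr => j _; rewrite mxE; apply: eq_bigr => i _; rewrite mxE.
Qed.

Lemma sum_pair_diag (X : 'M[R]_n) (Y : 'M[R]_l) :
  \sum_(ij : 'I_n * 'I_l) X ij.1 ij.1 * Y ij.2 ij.2 = \tr X * \tr Y.
Proof.
rewrite -(pair_bigA _ (fun i j => X i i * Y j j))/= /mxtrace big_distrl/=.
by apply: eq_bigr => i _; rewrite big_distrr.
Qed.

(** Expanding V^T [delta_mx i j] as the sum over a of V_ia [delta_mx a j] turns the sum over i into
    entries of V^T Y times a matrix. *)
Lemma sum_linear_orth q (V : 'M[R]_(n, q)) (Y : 'M[R]_(n, l)) (j : 'I_l)
    (L : 'M[R]_(q, l) -> 'M[R]_l) : linear L -> V^T *m Y = 0 ->
  \sum_i (Y *m L (V^T *m delta_mx i j)) i j = 0.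
Proof.
move=> linL VY.
pose Lf : {linear 'M[R]_(q, l) -> 'M[R]_l} :=
  HB.pack L (GRing.isLinear.Build _ _ _ _ L linL).
have dE i : V^T *m delta_mx i j = \sum_a V i a *: delta_mx a j :> 'M[R]_(q, l).
  apply/matrixP => a b; rewrite summxE (bigD1 a)//= big1 ?addr0 => [|h ha].
    rewrite !mxE eqxx/= (bigD1 i)//= big1 ?addr0 => [|h hi]; first by rewrite !mxE eqxx.
    by rewrite !mxE (negbTE hi) mulr0.
  by rewrite !mxE eq_sym (negbTE ha) mulr0.
have LZ c x : L (c *: x) = c *: L x by exact: (linearZ_LR Lf).
transitivity (\sum_i \sum_a V i a * (Y *m Lf (delta_mx a j)) i j).
  apply: eq_bigr => i _; rewrite dE -[L _]/(Lf _) linear_sum/= mulmx_sumr summxE.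
  by apply: eq_bigr => a _; rewrite /= LZ -scalemxAr mxE.
rewrite exchange_big/= big1// => a _.
transitivity ((V^T *m (Y *m Lf (delta_mx a j))) a j).
  by rewrite [RHS]mxE; apply: eq_bigr => i _; rewrite [X in _ = X * _]mxE.
by rewrite mulmxA VY mul0mx mxE.
Qed.

End delta_identities.

(** * The two Gaussian fields built from the regularized pseudoinverse *)

Section ridge_stein.
Context {dT : measure_display} {T : measurableType dT} {R : realType}.
Variable P : probability T R.
Context {n l q m : nat}.
Variable Omega : T -> 'M[R]_(n, l).
Hypothesis gOmega : gaussian_matrix P Omega.
Variables (V : 'M[R]_(n, q)) (e : R).
Hypotheses (VV : V^T *m V = 1%:M) (e0 : 0 < e).
Implicit Types M : 'M[R]_(n, l).

Let G M : 'M[R]_(q, l) := V^T *m M.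
Let W M : 'M[R]_q := ridge_inv e (G M).
Let K M : 'M[R]_(l, q) := ridge_pinv e (G M).
Let E i j : 'M[R]_(q, l) := V^T *m delta_mx i j.
(* [dK0 M D] is the derivative of [K] at [M] when [G M] moves in direction [D]. *)
Let dK0 M (D : 'M[R]_(q, l)) : 'M[R]_(l, q) :=
  D^T *m W M - K M *m D *m K M - K M *m G M *m D^T *m W M.
Let dK M i j := dK0 M (E i j).

Let boundedW : bounded_mx W.
Proof. by exists e^-1 => M i j; exact: ridge_inv_le. Qed.

Let boundedK : bounded_mx K.
Proof. by exists (1 + e^-1) => M i j; exact: ridge_pinv_le. Qed.

Let boundedKG : bounded_mx (fun M => K M *m G M).
Proof. by exists 1 => M i j; exact: ridge_proj_le. Qed.

(** G itself is unbounded, but in [dK0] it occurs only inside the product K G. *)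
Let bounded_dK i j : bounded_mx (fun M => dK M i j).
Proof.
apply: bounded_mxB; first apply: bounded_mxB.
- by apply: bounded_mxM => //; exact: bounded_mx_cst.
- by apply: bounded_mxM => //; apply: bounded_mxM => //; exact: bounded_mx_cst.
- by apply: bounded_mxM => //; apply: bounded_mxM => //; exact: bounded_mx_cst.
Qed.

Let measurableG : measurable_mx (G : box_mx R n l -> _).
Proof.
apply: measurable_mxM; first exact: measurable_mx_cst.
by move=> i j; exact: measurable_mx_entry.
Qed.

Let measurableW : measurable_mx (W : box_mx R n l -> _).
Proof.
apply: measurable_mx_inv; first by move=> M; exact: ridge_gram_unit.
apply: measurable_mxD; last exact: measurable_mx_cst.
by apply: measurable_mxM => //; exact: measurable_mxT.
Qed.

Let measurableK : measurable_mx (K : box_mx R n l -> _).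
Proof. by apply: measurable_mxM => //; exact: measurable_mxT. Qed.

Let measurable_dK i j : measurable_mx ((fun M => dK M i j) : box_mx R n l -> _).
Proof.
have mE := @measurable_mx_cst R _ (box_mx R n l).
apply: measurable_mxB; first apply: measurable_mxB.
- by apply: measurable_mxM => //; exact: mE.
- by apply: measurable_mxM => //; apply: measurable_mxM => //; exact: mE.
- apply: measurable_mxM => //; apply: measurable_mxM; last exact: mE.
  exact: measurable_mxM.
Qed.

Let derivG M i j x : is_derive_mx (fun y => G (M + y *: delta_mx i j)) x (E i j).
Proof.
have := is_derive_mxM (is_derive_mx_cst V^T x) (is_derive_mx_line M (delta_mx i j) x).
by rewrite mul0mx add0r.
Qed.

Let derivMl a b c (A : 'M[R]_(a, b)) (F : R -> 'M[R]_(b, c)) x F' :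
  is_derive_mx F x F' -> is_derive_mx (fun y => A *m F y) x (A *m F').
Proof.
move=> dF; have := is_derive_mxM (is_derive_mx_cst A x) dF.
by rewrite mul0mx add0r.
Qed.

Let derivW M i j : is_derive_mx (fun y => W (M + y *: delta_mx i j)) 0
  (- (W M *m (E i j *m (G M)^T + G M *m (E i j)^T) *m W M)).
Proof.
have M0 : M + 0 *: delta_mx i j = M by rewrite scale0r addr0.
have dN := is_derive_mxD (is_derive_mxM (derivG M i j 0) (is_derive_mxT (derivG M i j 0)))
  (is_derive_mx_cst e%:M 0).
have := is_derive_mx_inv (fun y => ridge_gram_unit e0 (G (M + y *: delta_mx i j))) dN.
by rewrite addr0 M0.
Qed.

Let derivK M i j : is_derive_mx (fun y => K (M + y *: delta_mx i j)) 0 (dK M i j).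
Proof.
have M0 : M + 0 *: delta_mx i j = M by rewrite scale0r addr0.
have := is_derive_mxM (is_derive_mxT (derivG M i j 0)) (derivW M i j).
rewrite M0 mulmxN mulmxDr mulmxDl mulmxDr opprD addrA.
rewrite /dK /dK0 /K /ridge_pinv -/(W M) => H.
suff -> : (E i j)^T *m W M - (G M)^T *m W M *m E i j *m ((G M)^T *m W M) -
    (G M)^T *m W M *m G M *m (E i j)^T *m W M =
  (E i j)^T *m W M - (G M)^T *m (W M *m (E i j *m (G M)^T) *m W M) -
    (G M)^T *m (W M *m (G M *m (E i j)^T) *m W M) by [].
by rewrite !mulmxA.
Qed.

(** Supplies, through differentiability, the continuity of the partial derivatives along each entry
    that integration by parts requires. *)
Let deriv_dK M i j : exists D, is_derive_mx (fun y => dK (M + y *: delta_mx i j) i j) 0 D.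
Proof.
have dE := is_derive_mx_cst (E i j) (0 : R).
have dET := is_derive_mx_cst (E i j)^T (0 : R).
eexists; apply: is_derive_mxB; first apply: is_derive_mxB.
- exact: (is_derive_mxM dET (derivW M i j)).
- exact: (is_derive_mxM (is_derive_mxM (derivK M i j) dE) (derivK M i j)).
- exact: (is_derive_mxM (is_derive_mxM (is_derive_mxM (derivK M i j) (derivG M i j 0))
    dET) (derivW M i j)).
Qed.

Let trmxB a b (A B : 'M[R]_(a, b)) : (A - B)^T = A^T - B^T.
Proof. by apply/matrixP => i j; rewrite !mxE. Qed.

Let subE a b (A B : 'M[R]_(a, b)) i j : (A - B) i j = A i j - B i j.
Proof. by rewrite !mxE. Qed.

(** With E = [delta_mx i j], the three terms of [dK0] become V W V^T E, V K^T E^T V K^T and V W V^T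
    E (K G)^T after transposition and multiplication by V; V^T V = 1 then removes V from the
    traces. *)
Let div_VK M : \sum_(ij : 'I_n * 'I_l) (V *m (dK M ij.1 ij.2)^T) ij.1 ij.2 =
  l%:R * \tr (W M) - sqnorm (K M) - \tr (K M *m G M) * \tr (W M).
Proof.
have WT : (W M)^T = W M by exact: trmx_ridge_inv.
have H i j : (V *m (dK M i j)^T) i j = (V *m W M *m V^T) i i * (1%:M : 'M[R]_l) j j -
    (V *m (K M)^T) i j * (V *m (K M)^T) i j - (V *m W M *m V^T) i i * (K M *m G M)^T j j.
  rewrite -!delta_sandwich -delta_sandwichT mulmx1 /dK /dK0 /E.
  by rewrite !trmxB !mulmxBr !subE !trmx_mul !trmxK WT !mulmxA.
under eq_bigr do rewrite H.
rewrite !sumrB sum_pair_trace !sum_pair_diag mxtrace1 mxtrace_tr.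
have -> : \tr (V *m W M *m V^T) = \tr (W M) by rewrite mxtrace_mulC mulmxA VV mul1mx.
have -> : \tr ((V *m (K M)^T)^T *m (V *m (K M)^T)) = sqnorm (K M).
  by rewrite trmx_mul trmxK -mulmxA (mulmxA V^T) VV mul1mx -sqnormT /sqnorm trmxK.
by rewrite [X in X - _ - _]mulrC [X in _ - X]mulrC.
Qed.

Let trace_VK M : \sum_(ij : 'I_n * 'I_l) M ij.1 ij.2 * (V *m (K M)^T) ij.1 ij.2 =
  q%:R - e * \tr (W M).
Proof.
rewrite sum_pair_trace mulmxA -mxtrace_tr !trmx_mul !trmxK.
by rewrite -(tr_ridge_proj e0 (G M)) /ridge_pinv /G trmx_mul trmxK !mulmxA.
Qed.

Let measurable_comp_Omega (f : 'M[R]_(n, l) -> R) :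
  measurable_fun setT (f : box_mx R n l -> R) ->
  measurable_fun setT (fun w => f (Omega w)).
Proof.
move=> mf; have mO : measurable_fun setT (Omega : T -> box_mx R n l).
  by apply: measurable_to_box_mx => i j; case: gOmega.
exact: (measurableT_comp mf mO).
Qed.

Lemma measurable_tr_ridge_inv : measurable_fun setT (fun w => \tr (W (Omega w))).
Proof. by apply: (@measurable_comp_Omega (fun M => \tr (W M))); exact: measurable_fun_tr. Qed.

(* The expected trace of an inverse Wishart matrix is [q / (l - q - 1)];
   the regularization only decreases it. *)
Lemma expectation_tr_ridge_inv : (q.+1 < l)%N ->
  (\int[P]_w (\tr (ridge_inv e (V^T *m Omega w)))%:E <= (q%:R / (l%:R - q%:R - 1))%:E)%E.
Proof.
move=> ql.
have c0 : 0 < l%:R - q%:R - 1 :> R by rewrite -addrA -opprD subr_gt0 -(natrD _ q 1)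
    ltr_nat addn1.
have [||||||i1 i2 E12] := @stein_field _ _ _ P _ _ _ gOmega
  (fun M => V *m (K M)^T) (fun i j M => V *m (dK M i j)^T).
- by apply: measurable_mxM; [exact: measurable_mx_cst|exact: measurable_mxT].
- move=> i j; apply: measurable_mxM; first exact: measurable_mx_cst.
  exact: (measurable_mxT (measurable_dK i j)).
- by move=> i j M; apply: derivMl; apply: is_derive_mxT; exact: derivK.
- move=> i j M; have [D dD] := deriv_dK M i j; eexists.
  by apply: derivMl; apply: is_derive_mxT; exact: dD.
- apply/growth_mx_bounded/bounded_mxM; first exact: bounded_mx_cst.
  exact: bounded_mxT.
- move=> i j; apply/growth_mx_bounded/bounded_mxM; first exact: bounded_mx_cst.
  exact: (bounded_mxT (bounded_dK i j)).
have tr0 w : 0 <= \tr (W (Omega w)) by exact: tr_ridge_inv_ge0.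
set c : R := l%:R - q%:R - 1 in c0 *.
(* The slack is e (tr W)^2 plus tr W - ||K||^2, both nonnegative. *)
have le2 w : c * \tr (W (Omega w)) <=
    \sum_(ij : 'I_n * 'I_l) (V *m (dK (Omega w) ij.1 ij.2)^T) ij.1 ij.2.
  have KW : sqnorm (K (Omega w)) <= \tr (W (Omega w)) by exact: sqnorm_ridge_pinv_le.
  have KG : \tr (K (Omega w) *m G (Omega w)) = q%:R - e * \tr (W (Omega w)).
    exact: tr_ridge_proj.
  rewrite div_VK KG /c; have := mulr_ge0 (ltW e0) (sqr_ge0 (\tr (W (Omega w)))); nra.
have iW : P.-integrable setT (fun w => (c * \tr (W (Omega w)))%:E).
  apply: le_integrable i2 => //.
    by apply/measurable_EFinP; apply: measurable_funM => //; exact: measurable_tr_ridge_inv.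
  move=> w _; rewrite lee_fin !ger0_norm ?le2//; last by rewrite mulr_ge0// ltW.
  by rewrite (le_trans _ (le2 w))// mulr_ge0// ltW.
rewrite mulrC EFinM lee_pdivlMl// -ge0_integralZl//=; last 3 first.
- by apply/measurable_EFinP; exact: measurable_tr_ridge_inv.
- by move=> w _; rewrite lee_fin; exact: tr0.
- by rewrite lee_fin ltW.
apply: (@le_trans _ _ (\int[P]_w (q%:R)%:E)%E); last first.
  by rewrite integral_cst//= probability_setT mule1.
apply: (@le_trans _ _ (\int[P]_w (\sum_(ij : 'I_n * 'I_l)
    (V *m (dK (Omega w) ij.1 ij.2)^T) ij.1 ij.2)%:E)%E).
  by apply: le_integral => //; move=> w _; rewrite lee_fin le2.
rewrite -E12; apply: le_integral => //; first exact: finite_measure_integrable_cst.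
by move=> w _; rewrite lee_fin trace_VK lerBlDr lerDl mulr_ge0// ltW.
Qed.

Variable B : 'M[R]_(m, n).
Hypothesis BV : B *m V = 0.

Let dKK M i j : 'M[R]_l := dK M i j *m (K M)^T + K M *m (dK M i j)^T.

Let field2 M := B^T *m B *m M *m (K M *m (K M)^T).
Let dfield2 i j M :=
  B^T *m B *m delta_mx i j *m (K M *m (K M)^T) + B^T *m B *m M *m dKK M i j.

(* [K] depends on [M] only through [V^T *m M] and [V^T *m B^T = 0], so the
   derivative of [K] contributes nothing to the divergence. *)
Let sum_dfield2 M : \sum_(ij : 'I_n * 'I_l) dfield2 ij.1 ij.2 M ij.1 ij.2 =
  sqnorm B * sqnorm (K M).
Proof.
have -> : sqnorm (K M) = \tr (K M *m (K M)^T) by rewrite mxtrace_mulC.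
rewrite -sum_pair_diag.
under eq_bigr do rewrite mxE delta_sandwich.
rewrite big_split/= [X in _ + X](_ : _ = 0) ?addr0//.
rewrite -(pair_bigA _ (fun i j => (B^T *m B *m M *m dKK M i j) i j))/= exchange_big/=.
apply: big1 => j _.
pose L D : 'M[R]_l := dK0 M D *m (K M)^T + K M *m (dK0 M D)^T.
apply: (@sum_linear_orth _ _ _ _ V _ j L).
  have dK0L c D1 D2 : dK0 M (c *: D1 + D2) = c *: dK0 M D1 + dK0 M D2.
    rewrite /dK0 linearP/= !mulmxDl !mulmxDr !mulmxDl -!scalemxAl -!scalemxAr -!scalemxAl.
    have aux (x1 x2 x3 y1 y2 y3 : 'M[R]_(l, q)) :
        x1 + y1 - (x2 + y2) - (x3 + y3) = (x1 - x2 - x3) + (y1 - y2 - y3).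
      by rewrite !opprD (addrACA x1 y1) (addrACA (x1 - x2)).
    by rewrite aux !scalerBr.
  move=> c D1 D2; rewrite /L dK0L linearP/= mulmxDl mulmxDr -scalemxAl -scalemxAr.
  by rewrite scalerDr addrACA.
by rewrite !mulmxA -trmx_mul BV trmx0 !mul0mx.
Qed.

(** Probabilistically, B O and V^T O are independent because B V = 0. Here this appears as a
    divergence in which only the explicit factor O is differentiated; the pairing of [field2] with O
    is ||B O K||^2. *)
Lemma expectation_sqnorm_orth :
  (\int[P]_w (sqnorm (B *m Omega w *m ridge_pinv e (V^T *m Omega w)))%:E =
   \int[P]_w (sqnorm B * sqnorm (ridge_pinv e (V^T *m Omega w)))%:E)%E.
Proof.
have mid : measurable_mx (id : box_mx R n l -> 'M[R]_(n, l)).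
  by move=> i j; exact: measurable_mx_entry.
have mcst := @measurable_mx_cst R _ (box_mx R n l).
have bKK : bounded_mx (fun M => K M *m (K M)^T).
  by apply: bounded_mxM => //; exact: bounded_mxT.
have bdKK i j : bounded_mx (fun M => dKK M i j).
  apply: bounded_mxD; apply: bounded_mxM => //.
    exact: bounded_mxT.
  exact: (bounded_mxT (bounded_dK i j)).
have dKKd M i j : is_derive_mx (fun y => K (M + y *: delta_mx i j) *m (K (M + y *:
    delta_mx i j))^T) 0 (dKK M i j).
  have := is_derive_mxM (derivK M i j) (is_derive_mxT (derivK M i j)).
  by rewrite scale0r addr0.
have [||||||i1 i2 E12] := @stein_field _ _ _ P _ _ _ gOmega field2 dfield2.
- apply: measurable_mxM; first by apply: measurable_mxM => //; exact: mcst.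
  by apply: measurable_mxM => //; exact: measurable_mxT.
- move=> i j; apply: measurable_mxD; apply: measurable_mxM.
  + exact: mcst.
  + by apply: measurable_mxM => //; exact: measurable_mxT.
  + by apply: measurable_mxM => //; exact: mcst.
  + apply: measurable_mxD; apply: measurable_mxM => //.
      exact: measurable_mxT.
    exact: (measurable_mxT (measurable_dK i j)).
- move=> i j M; rewrite /field2 /dfield2.
  have := is_derive_mxM (derivMl (B^T *m B) (is_derive_mx_line M (delta_mx i j) 0))
      (dKKd M i j).
  by rewrite scale0r addr0.
- move=> i j M; have [D dD] := deriv_dK M i j; eexists; apply: is_derive_mxD.
    by apply: derivMl; exact: dKKd.
  apply: is_derive_mxM; first exact: (derivMl _ (is_derive_mx_line M (delta_mx i j) 0)).
  apply: is_derive_mxD; apply: is_derive_mxM.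
  + exact: dD.
  + by apply: is_derive_mxT; exact: derivK.
  + exact: derivK.
  + by apply: is_derive_mxT; exact: dD.
(* The explicit factor M makes this field unbounded; its growth is linear because K K^T is
   bounded. *)
- apply: growth_mxMr => //; apply: growth_mxMl; first exact: bounded_mx_cst.
  exact: growth_mx_id.
- move=> i j; apply: growth_mxD.
    by apply/growth_mx_bounded/bounded_mxM => //; exact: bounded_mx_cst.
  apply: growth_mxMr => //; apply: growth_mxMl; first exact: bounded_mx_cst.
  exact: growth_mx_id.
transitivity (\int[P]_w (\sum_(ij : 'I_n * 'I_l) Omega w ij.1 ij.2 * field2 (Omega w)
    ij.1 ij.2)%:E)%E.
  apply: eq_integral => w _; rewrite sum_pair_trace /field2 /sqnorm; congr (_%:E).
  rewrite /K /G; move: (ridge_pinv e _) => k.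
  by rewrite [(B *m _ *m _)^T]trmx_mul [(B *m _)^T]trmx_mul !mulmxA [RHS]mxtrace_mulC !mulmxA.
rewrite E12; apply: eq_integral => w _.
by rewrite sum_dfield2.
Qed.

End ridge_stein.

(** * Spectral theorem for real symmetric matrices *)

Section real_spectral.
Context {R : realType}.

Lemma trmx11 (M : 'M[R]_1) : M^T = M.
Proof. by apply/matrixP => i j; rewrite mxE !ord1. Qed.

(** The reflection along w = u - e1. Since u and e1 have equal length, w^T e1 = - ||w||^2 / 2, hence
    H e1 = e1 + w = u. *)
Lemma householder n (u : 'cV[R]_n.+1) : u^T *m u = 1%:M ->
  exists2 H : 'M[R]_n.+1, H^T *m H = 1%:M & H *m delta_mx 0 (0 : 'I_1) = u.
Proof.
move=> uu; pose e : 'cV[R]_n.+1 := delta_mx 0 0.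
have ee : e^T *m e = 1%:M.
  by rewrite trmx_delta mul_delta_mx; apply/matrixP => i j; rewrite !ord1 !mxE.
have [->|ue] := eqVneq u e; first by exists 1%:M; rewrite ?trmx1 mul1mx.
pose w := u - e; pose a := (w^T *m w) 0 0.
have wwE : w^T *m w = a%:M by exact: mx11_scalar.
have a0 : a != 0.
  apply: contra ue => /eqP a0; rewrite -subr_eq0; apply/eqP.
  by apply: sqnorm_eq0; rewrite /sqnorm wwE a0 mxtrace_scalar mul0rn.
have weE : w^T *m e = (- (a / 2))%:M.
  have ueT : e^T *m u = u^T *m e.
    by rewrite -[LHS]trmx11 trmx_mul trmxK.
  have wT : w^T = u^T - e^T by apply/matrixP => i j; rewrite !mxE.
  have := wwE; rewrite wT mulmxBl /w !mulmxBr uu ee ueT mulmxBl ee.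
  rewrite [u^T *m e]mx11_scalar; set c := (u^T *m e) 0 0.
  move=> /matrixP/(_ 0 0); rewrite !mxE eqxx !mulr1n => <-.
  by apply/matrixP => i j; rewrite !ord1 !mxE eqxx !mulr1n; field.
pose H := 1%:M - (2 / a) *: (w *m w^T).
have HT : H^T = H by rewrite /H linearB linearZ/= trmx1 trmx_mul trmxK.
exists H.
  rewrite HT /H mulmxBl !mulmxBr mul1mx mulmx1 mul1mx -scalemxAl -scalemxAr scalerA.
  have -> : w *m w^T *m (w *m w^T) = a *: (w *m w^T).
    by rewrite mulmxA -(mulmxA w) wwE mul_mx_scalar -scalemxAl.
  rewrite scalerA (_ : _ * a = 2 / a + 2 / a); last by field.
  by rewrite scalerDl opprB addrK subrK.
rewrite /H mulmxBl mul1mx -scalemxAl -mulmxA weE mul_mx_scalar scalerA.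
by rewrite (_ : 2 / a * _ = -1) ?scaleN1r ?opprK /w ?subrKC//; field.
Qed.

Lemma char_poly_conj n (H S : 'M[R]_n) : H^T *m H = 1%:M ->
  char_poly (H^T *m S *m H) = char_poly S.
Proof.
move=> HH; rewrite /char_poly; set pH := map_mx polyC H; set pHT := map_mx polyC H^T.
have pHH : pHT *m pH = 1%:M by rewrite -map_mxM HH map_mx1.
have -> : char_poly_mx (H^T *m S *m H) = pHT *m char_poly_mx S *m pH.
  rewrite /char_poly_mx mulmxBr mulmxBl !map_mxM; congr (_ - _).
  by rewrite scalar_mxC -mulmxA pHH mulmx1.
by rewrite !det_mulmx mulrAC -det_mulmx pHH det1 mul1r.
Qed.

(** The list of roots is an argument, so the diagonal comes in a prescribed order. A reflection
    sends e1 to a unit eigenvector of the first root x; symmetry makes the conjugate block diagonal,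
    and cancelling X - x in the characteristic polynomial leaves the remaining roots to the smaller
    block. *)
Lemma real_spectral n (S : 'M[R]_n) (s : seq R) : S^T = S ->
  char_poly S = \prod_(x <- s) ('X - x%:P) ->
  exists2 U : 'M[R]_n, U^T *m U = 1%:M & U^T *m S *m U = diag_mx (\row_i s`_i).
Proof.
elim: n => [|n IH] in S s *.
  by move=> _ _; exists 1%:M; apply/matrixP => -[].
move=> ST chS.
have sz : size s = n.+1.
  have := congr1 (fun p : {poly R} => size p) chS.
  by rewrite size_char_poly size_prod_XsubC => -[].
case: s => [//|x s] in chS sz *.
have : eigenvalue S x.
  by rewrite eigenvalue_root_char chS root_prod_XsubC mem_head.
move=> /eigenvalueP[v vS v0].
have vv0 : 0 < sqnorm v by rewrite lt_neqAle eq_sym sqnorm_ge0 andbT;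
    apply: contra v0 => /eqP/sqnorm_eq0 ->.
pose u := (Num.sqrt (sqnorm v))^-1 *: v^T.
have uu : u^T *m u = 1%:M.
  rewrite [LHS]mx11_scalar -trace_mx11 -/(sqnorm u) sqnormZ sqnormT exprVn sqr_sqrtr ?ltW//.
  by rewrite mulVf ?gt_eqF.
have Su : S *m u = x *: u.
  by rewrite -scalemxAr -[S *m v^T]trmxK trmx_mul trmxK ST vS linearZ/= !scalerA mulrC.
have [H HH He] := householder uu.
pose S1 := H^T *m S *m H.
have S1T : S1^T = S1 by rewrite /S1 !trmx_mul trmxK ST mulmxA.
have S1e : S1 *m delta_mx 0 (0 : 'I_1) = x *: delta_mx 0 0.
  by rewrite /S1 -mulmxA He -mulmxA Su -scalemxAr -He mulmxA HH mul1mx.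
(* The size is restated as 1 + n to expose the blocks; the body is cleared once the facts about it
   are recorded. *)
pose S1' : 'M[R]_(1 + n) := S1.
have col0 i : S1' i 0 = x *+ (i == 0).
  have := congr1 (fun M : 'cV[R]_n.+1 => M i 0) S1e.
  rewrite -colE !mxE andbT => ->.
  by rewrite mulr_natr.
have S1'T : S1'^T = S1' by [].
have S1'def : H^T *m S *m H = S1' by [].
have chS1 : char_poly S1' = char_poly S by exact: char_poly_conj.
clearbody S1'.
have S1E : S1' = block_mx x%:M 0 0 (drsubmx S1').
  rewrite -[LHS]submxK; congr block_mx.
  - apply/matrixP => i j; rewrite !ord1 !mxE.
    by have := col0 0; rewrite eqxx; apply: etrans; congr (S1' _ _); apply: val_inj.
  - apply/matrixP => i j; rewrite !ord1 !mxE -S1'T mxE.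
    have := col0 (rshift 1 j); rewrite (_ : rshift 1 j == 0 = false)//.
    by apply: etrans; congr (S1' _ _); apply: val_inj.
  - apply/matrixP => i j; rewrite !ord1 !mxE.
    have := col0 (rshift 1 i); rewrite (_ : rshift 1 i == 0 = false)//.
    by apply: etrans; congr (S1' _ _); apply: val_inj.
have S2T : (drsubmx S1')^T = drsubmx S1' by rewrite trmx_drsub S1'T.
have chS2 : char_poly (drsubmx S1') = \prod_(y <- s) ('X - y%:P).
  have : char_poly S1' = ('X - x%:P) * \prod_(y <- s) ('X - y%:P).
    by rewrite chS1 chS big_cons.
  rewrite {1}S1E /char_poly char_block_diag_mx det_ublock -/(char_poly _).
  rewrite /char_poly_mx map_scalar_mx -raddfB/= det_scalar1.
  by apply: mulfI; rewrite polyXsubC_eq0.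
have [U' UU' US'] := IH _ _ S2T chS2.
pose W : 'M[R]_(1 + n) := block_mx 1%:M 0 0 U'.
have WW : W^T *m W = 1%:M.
  rewrite /W tr_block_mx mulmx_block !trmx0 trmx1 !mul1mx !mulmx0 !mul0mx !addr0 add0r.
  by rewrite UU' -scalar_mx_block.
exists (H *m (W : 'M[R]_n.+1)).
  by rewrite trmx_mul mulmxA -(mulmxA W^T) HH mulmx1.
have -> : (H *m (W : 'M[R]_n.+1))^T *m S *m (H *m (W : 'M[R]_n.+1)) = W^T *m S1' *m W.
  by rewrite -S1'def trmx_mul !mulmxA.
rewrite S1E /W tr_block_mx !mulmx_block !trmx0 trmx1.
rewrite !(mul1mx, mulmx0, mul0mx, mulmx1, addr0, add0r) US'.
pose D : 'M[R]_(1 + n) := diag_mx (\row_(i < n.+1) (x :: s)`_i).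
have D1 : ulsubmx D = x%:M by apply/matrixP => i j; rewrite !ord1 !mxE/=.
have D2 : ursubmx D = 0 by apply/matrixP => i j; rewrite !ord1 !mxE.
have D3 : dlsubmx D = 0 by apply/matrixP => i j; rewrite !ord1 !mxE.
have D4 : drsubmx D = diag_mx (\row_i s`_i) by apply/matrixP => i j; rewrite !mxE/=.
by rewrite -[RHS]/D -[D]submxK D1 D2 D3 D4.
Qed.

End real_spectral.

(** * Right singular vectors of the largest singular values *)

Section dominant_subspace.
Context {R : realType} {m n : nat}.
Variable A : 'M[R]_(m, n).
Let S := A^T *m A.
Let s := eigenvalues S.

Let ST : S^T = S. Proof. by rewrite trmx_mul trmxK. Qed.

Let size_s : size s = n. Proof. exact: size_eigenvalues. Qed.

Let s_ge0 i : 0 <= s`_i.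
Proof.
have [ni|ni] := leqP n i; first by rewrite nth_default// size_s.
by apply: (@eigenvalues_gram_ge0 _ _ _ A); rewrite mem_nth// -/S -/s size_s.
Qed.

Let s_anti i j : (i <= j)%N -> (j < n)%N -> s`_j <= s`_i.
Proof.
move=> ij jn; have [ss _] := eigenvaluesP ST.
have := @sorted_leq_nth R >=%R (fun y x z => (fun h1 h2 => le_trans h2 h1)) (fun x =>
    lexx x) 0 s ss i j.
by rewrite !inE size_s; apply => //; exact: leq_ltn_trans jn.
Qed.

Let diagonalized : exists2 U : 'M[R]_n, U^T *m U = 1%:M & U^T *m S *m U = diag_mx
    (\row_i s`_i).
Proof. by apply: real_spectral => //; have [_] := eigenvaluesP ST. Qed.

(** Otherwise the first m + 1 eigenvalues would be positive, and A applied to their eigenvectors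
    would give an m x (m + 1) matrix with invertible Gram matrix, against rank at most m. This
    reconciles the trace, a sum of n eigenvalues, with the min(m, n) singular values. *)
Let s_small i : (m <= i)%N -> s`_i = 0.
Proof.
move=> mi; have [ni|ni] := leqP n i; first by rewrite nth_default// size_s.
apply/eqP; case: eqVneq => // si0; exfalso.
have mn : (m.+1 <= n)%N by exact: leq_ltn_trans ni.
have pos (j : 'I_m.+1) : 0 < s`_j.
  rewrite (@lt_le_trans _ _ s`_i)//; first by rewrite lt_neqAle eq_sym si0 s_ge0.
  by apply: s_anti => //; apply: leq_trans mi; rewrite -ltnS.
have [U UU US] := diagonalized.
pose C : 'M[R]_(m, m.+1) := A *m colsub (widen_ord mn) U.
have CC : C^T *m C = diag_mx (\row_(j < m.+1) s`_j).
  have -> : C^T *m C = mxsub (widen_ord mn) (widen_ord mn) (U^T *m S *m U).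
    rewrite /C trmx_mul mulmxA -(mulmxA _ A^T) -/S trmx_mxsub.
    by rewrite mul_rowsub_mx mulmx_colsub mul_rowsub_mx -mxsub_comp.
  rewrite US; apply/matrixP => a b; rewrite !mxE.
  by rewrite -val_eqE/= -val_eqE/=.
have : C^T *m C \in unitmx.
  rewrite CC unitmxE det_diag unitfE; apply/prodf_neq0 => j _.
  by rewrite mxE gt_eqF.
move=> /mxrank_unit rk.
have := leq_trans (mxrankM_maxr C^T C) (rank_leq_row C).
by rewrite rk ltnn.
Qed.

Lemma dominant_subspace r :
  exists (V : 'M[R]_(n, minn r n)) (d : 'rV[R]_(minn r n)),
    [/\ V^T *m V = 1%:M, A^T *m A *m V = V *m diag_mx d,
        forall i, 0 <= d 0 i &
        \tr (A^T *m A) - \sum_i d 0 i =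
        \sum_(r.+1 <= j < (minn m n).+1) singular_value j A ^+ 2].
Proof.
have [U UU US] := diagonalized.
have UU' : U *m U^T = 1%:M by exact: mulmx1C.
pose f : 'I_(minn r n) -> 'I_n := widen_ord (geq_minr r n).
exists (colsub f U), (\row_i s`_i); split.
- by rewrite trmx_mxsub mul_rowsub_mx mulmx_colsub UU; apply/matrixP => i j;
    rewrite !mxE -val_eqE.
- have SU : S *m U = U *m diag_mx (\row_i s`_i) by rewrite -US !mulmxA UU' mul1mx.
  rewrite -/S mulmx_colsub SU; apply/matrixP => i j.
  by rewrite [LHS]mxE !mul_mx_diag !mxE.
- by move=> i; rewrite mxE.
have -> : \tr (A^T *m A) = \sum_(i < n) s`_i.
  have -> : A^T *m A = S by [].
  transitivity (\tr (U^T *m S *m U)); first by rewrite [RHS]mxtrace_mulC mulmxA UU' mul1mx.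
  by rewrite US mxtrace_diag; apply: eq_bigr => i _; rewrite mxE.
under [X in _ - X]eq_bigr do rewrite mxE.
rewrite -(big_mkord xpredT (fun i => s`_i)) -(big_mkord xpredT (fun i => s`_i)).
(* Singular values count from 1, list positions from 0. *)
have svE j : (r < j)%N -> (j <= minn m n)%N -> singular_value j A ^+ 2 = s`_j.-1.
  case: j => [//|j] _ jmn; rewrite /singular_value /singular_values -/S -/s/=.
  rewrite nth_take// (nth_map 0) ?sqr_sqrtr//.
  by rewrite size_s (leq_trans jmn)// geq_minr.
rewrite (big_cat_nat _ (geq_minr r n))//= addrAC subrr add0r.
rewrite big_add1/=.
transitivity (\sum_(r <= j < minn m n) s`_j); last first.
  apply: eq_big_nat => j /andP[rj jmn].
  by rewrite svE.
(* For n < r both sums are empty; otherwise the extra indices on the left are at least m, where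
   [s_small] applies. *)
have [rn|nr] := leqP r n; last first.
  rewrite big_geq// big_geq// geq_min; apply/orP; right; exact: ltnW.
have [rmn|mnr] := leqP r (minn m n).
  rewrite (big_cat_nat rmn (geq_minr m n))/= [X in _ + X]big1_seq ?addr0// => j.
  rewrite mem_index_iota => /andP[_ /andP[mj jn]].
  apply: s_small; move: mj; rewrite geq_min => /orP[//|]; by rewrite leqNgt jn.
rewrite [RHS]big_geq ?(ltnW mnr)// big1_seq// => j.
rewrite mem_index_iota => /andP[_ /andP[rj jn]].
apply: s_small; have := leq_trans (ltnW mnr) rj.
by rewrite geq_min => /orP[//|]; rewrite leqNgt jn.
Qed.

End dominant_subspace.

(** * Expected error of the randomized range finder *)

Section projector.
Context {R : realType}.

(** 1 - Q annihilates M, so (1 - Q) A = (1 - Q) (A - M X), and by Pythagoras an orthogonal projector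
    does not increase the norm. *)
Lemma sqnormB_projector m n k (A : 'M[R]_(m, n)) (M : 'M[R]_(m, k)) (X : 'M[R]_(k, n)) :
  sqnorm ((1%:M - col_projector M) *m A) <= sqnorm (A - M *m X).
Proof.
set Q := col_projector M.
have [MXM _ QT _] := moore_penroseP M; rewrite -/(col_projector M) -/Q in MXM QT.
have QQ : Q *m Q = Q by rewrite {2}/Q /col_projector mulmxA MXM.
set Y := A - M *m X.
have <- : (1%:M - Q) *m Y = (1%:M - Q) *m A.
  rewrite /Y mulmxBr mulmxA (_ : (1%:M - Q) *m M = 0) ?mul0mx ?subr0//.
  by rewrite mulmxBl mul1mx MXM subrr.
have {2}-> : Y = Q *m Y + (1%:M - Q) *m Y by rewrite -mulmxDl subrKC mul1mx.
rewrite sqnormD_orth ?lerDr ?sqnorm_ge0//.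
rewrite trmx_mul QT -mulmxA (mulmxA Q) [Q *m (_ - _)]mulmxBr mulmx1 QQ subrr.
by rewrite mul0mx mulmx0 mxtrace0.
Qed.

Lemma projector_residual m n k (A : 'M[R]_(m, n)) (M : 'M[R]_(m, k)) :
  (1%:M - col_projector M) *m A = A - M *m (moore_penrose M *m A).
Proof. by rewrite mulmxBl mul1mx mulmxA. Qed.

(** From A O = B O + A V (V^T O) and V^T O K = 1 - e W, the error for X = K V^T is B + (e A V W - B
    O K) V^T. The three pieces are orthogonal: B V = 0, and B^T A V = 0 because the columns of V are
    eigenvectors of A^T A. *)
Lemma sketch_residual_le m n k q (A : 'M[R]_(m, n)) (V : 'M[R]_(n, q))
    (d : 'rV[R]_q) (O : 'M[R]_(n, k)) (B : 'M[R]_(m, n)) (e : R) :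
  0 < e -> B = A - A *m V *m V^T -> V^T *m V = 1%:M -> A^T *m A *m V = V *m diag_mx d ->
  (forall i, 0 <= d 0 i) ->
  sqnorm ((1%:M - col_projector (A *m O)) *m A) <=
  sqnorm B + sqnorm (B *m O *m ridge_pinv e (V^T *m O)) +
  e * ((\sum_i d 0 i) * \tr (ridge_inv e (V^T *m O))).
Proof.
move=> e0 BE VV AAV d0.
have BV : B *m V = 0 by rewrite BE mulmxBl -(mulmxA _ V^T V) VV mulmx1 subrr.
set K := ridge_pinv e _; set W := ridge_inv e _.
apply: le_trans (sqnormB_projector _ _ (K *m V^T)) _.
pose Z := e *: (A *m V *m W) - B *m O *m K.
have -> : A - A *m O *m (K *m V^T) = B + Z *m V^T.
  have AO : A *m O *m K = B *m O *m K + A *m V - e *: (A *m V *m W).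
    have -> : A *m O = B *m O + A *m V *m (V^T *m O).
      by rewrite BE mulmxBl mulmxA subrK.
    rewrite mulmxDl -[A *m V *m _ *m K]mulmxA mul_ridge_pinv// mulmxBr mulmx1 addrA.
    by rewrite -scalemxAr.
  rewrite mulmxA AO /Z; set x := B *m O *m K; set y := A *m V; set z := e *: _.
  rewrite mulmxBl mulmxDl mulmxBl -[A in LHS](subrK (y *m V^T)) -BE.
  move: (y *m V^T) (x *m V^T) (z *m V^T) => Y X U.
  by apply/matrixP => i j; rewrite !mxE; ring.
rewrite sqnormD_orth; last first.
  by rewrite mxtrace_mulC -mulmxA -trmx_mul BV trmx0 mulmx0 mxtrace0.
have -> : sqnorm (Z *m V^T) = sqnorm Z.
  by rewrite -sqnormT trmx_mul trmxK /sqnorm trmx_mul trmxK -mulmxA (mulmxA V^T) VV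
      mul1mx mxtrace_mulC.
rewrite -addrA lerD2l /Z addrC sqnormD_orth; last first.
  have H : B^T *m (A *m V) = 0.
    have -> : B^T = A^T - V *m V^T *m A^T.
      by rewrite BE linearB/= !trmx_mul trmxK mulmxA.
    rewrite mulmxBl mulmxA AAV -[V *m V^T *m _ *m _]mulmxA -mulmxA (mulmxA A^T) AAV.
    by rewrite !mulmxA -(mulmxA V) VV mulmx1 subrr.
  have HT : (A *m V)^T *m B = 0 by rewrite -[LHS]trmxK trmx_mul trmxK H trmx0.
  have -> : (e *: (A *m V *m W))^T = e *: (W^T *m (A *m V)^T) by rewrite linearZ/= trmx_mul.
  rewrite mulmxN -scalemxAl -[W^T *m _ *m _]mulmxA !(mulmxA (A *m V)^T) HT.
  by rewrite !mul0mx mulmx0 scaler0 oppr0 mxtrace0.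
have -> : sqnorm (- (B *m O *m K)) = sqnorm (B *m O *m K).
  by rewrite -scaleN1r sqnormZ sqrrN expr1n mul1r.
rewrite lerD2r sqnormZ expr2 -mulrA ler_pM2l//.
have WT : W^T = W by exact: trmx_ridge_inv.
(* Each d_i is bounded by the sum of all; this crude constant only multiplies a term that vanishes
   with e. *)
apply: (@le_trans _ _ (e * ((\sum_i d 0 i) * sqnorm W))); last first.
  rewrite mulrCA ler_wpM2l ?sumr_ge0//; exact: sqnorm_ridge_inv_le.
rewrite ler_pM2l//.
have -> : sqnorm (A *m V *m W) = \sum_i \sum_j d 0 i * W i j ^+ 2.
  rewrite /sqnorm !trmx_mul -!mulmxA (mulmxA A^T) (mulmxA _ V) AAV (mulmxA V^T).
  rewrite (mulmxA V^T) VV mul1mx mul_diag_mx /mxtrace exchange_big/=.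
  apply: eq_bigr => j _; rewrite mxE; apply: eq_bigr => i _.
  by rewrite !mxE expr2 mulrCA.
rewrite sqnormE mulr_sumr; apply: ler_sum => i _; rewrite mulr_sumr; apply: ler_sum => j _.
rewrite ler_wpM2r ?sqr_ge0// (bigD1 i)//= lerDl; exact: sumr_ge0.
Qed.

Lemma sqnorm_complement m n q (A : 'M[R]_(m, n)) (V : 'M[R]_(n, q)) (d : 'rV[R]_q) :
  V^T *m V = 1%:M -> A^T *m A *m V = V *m diag_mx d ->
  sqnorm (A - A *m V *m V^T) = \tr (A^T *m A) - \sum_i d 0 i.
Proof.
move=> VV AAV.
have -> : \sum_i d 0 i = sqnorm (A *m V *m V^T).
  rewrite -mxtrace_diag -sqnormT trmx_mul trmxK /sqnorm trmx_mul trmxK.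
  rewrite -mulmxA (mulmxA V^T) VV mul1mx mxtrace_mulC trmx_mul -mulmxA (mulmxA A^T) AAV.
  by rewrite mulmxA VV mul1mx.
apply/eqP; rewrite -/(sqnorm A) eq_sym subr_eq eq_sym; apply/eqP.
rewrite -sqnormD_orth ?subrK// mxtrace_mulC -(mulmxA (A *m V)) -trmx_mul mulmxBl.
by rewrite -(mulmxA _ V^T V) VV mulmx1 subrr trmx0 mulmx0 mxtrace0.
Qed.

End projector.

(** * Measurability of the residual *)

Section residual_measurable.
Context {R : realType}.

Lemma measurable_fun_sqnorm d (S : measurableType d) a b (F : S -> 'M[R]_(a, b)) :
  measurable_mx F -> measurable_fun setT (fun s => sqnorm (F s)).
Proof.
move=> mF; apply: measurable_fun_tr; apply: measurable_mxM => //.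
exact: measurable_mxT.
Qed.

Lemma cvg_bigsum (I : Type) (s : seq I) (u : I -> nat -> R) (v : I -> R) :
  (forall i, u i k @[k --> \oo] --> v i) ->
  \sum_(i <- s) u i k @[k --> \oo] --> \sum_(i <- s) v i.
Proof.
move=> uv; elim: s => [|i s IH].
  by rewrite big_nil; under eq_fun do rewrite big_nil; exact: cvg_cst.
by rewrite big_cons; under eq_fun do rewrite big_cons; exact: cvgD.
Qed.

Lemma rat_mx_approx a b (X : 'M[R]_(a, b)) :
  exists Y : nat -> 'M[rat]_(a, b),
    forall i j, ratr (Y k i j) @[k --> \oo] --> X i j.
Proof.
have H (x : R) (k : nat) : exists y : rat, `|ratr y - x| < k.+1%:R^-1.
  have k0 : 0 < k.+1%:R^-1 :> R by rewrite invr_gt0.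
  have [|y] := @rat_in_itvoo R (x - k.+1%:R^-1) (x + k.+1%:R^-1).
    by rewrite ltrBlDr -addrA ltrDl addr_gt0.
  by rewrite in_itv/= => yx; exists y; rewrite ltr_distl.
pose y x k := projT1 (cid (H x k)).
have yx x k : `|ratr (y x k) - x| < k.+1%:R^-1 by rewrite /y; case: cid.
exists (fun k => \matrix_(i, j) y (X i j) k) => i j.
under eq_fun do rewrite mxE.
apply/cvgrPdist_lt => e e0; near=> k.
rewrite distrC (lt_trans (yx _ _))//; near: k.
exact: (near_infty_natSinv_lt (PosNum e0)).
Unshelve. all: by end_near. Qed.

(** The pseudoinverse jumps where the rank drops, so it is avoided: for fixed s the bound ||F - G
    X||^2 < c is open in X, hence satisfied by a rational X as soon as it holds at the minimizer. *)
Lemma measurable_residual d (S : measurableType d) m n k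
    (F : S -> 'M[R]_(m, n)) (G : S -> 'M[R]_(m, k)) :
  measurable_mx F -> measurable_mx G ->
  measurable_fun setT (fun s => sqnorm ((1%:M - col_projector (G s)) *m F s)).
Proof.
move=> mF mG.
apply: (measurability _ (RGenInftyO.measurableE R)) => _ [_ [c ->] <-]; rewrite setTI.
rewrite (_ : _ @^-1` _ = \bigcup_(X : 'M[rat]_(k, n))
    (fun s => sqnorm (F s - G s *m map_mx ratr X)) @^-1` `]-oo, c[); last first.
  apply/seteqP; split => s /=; rewrite ?in_itv/=; last first.
    move=> [X _] /=; rewrite !in_itv/=; apply: le_lt_trans.
    exact: sqnormB_projector.
  rewrite projector_residual; set X := _ *m F s => Xc.
  have [Y YX] := rat_mx_approx X.
  have cv : sqnorm (F s - G s *m map_mx ratr (Y j)) @[j --> \oo] --> sqnorm (F s - G s *m X).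
    rewrite sqnormE; under eq_fun do rewrite sqnormE.
    apply: cvg_bigsum => i; apply: cvg_bigsum => i'.
    under eq_fun do rewrite expr2; rewrite expr2.
    suff H : (F s - G s *m map_mx ratr (Y j)) i i' @[j --> \oo] --> (F s - G s *m X) i
        i' by exact: cvgM.
    rewrite !mxE; under eq_fun do rewrite !mxE.
    apply: cvgB; first exact: cvg_cst.
    apply: cvg_bigsum => h; apply: cvgM; first exact: cvg_cst.
    by under eq_fun do rewrite mxE; exact: YX.
  have [j _ /(_ _ (leqnn _)) jc] := cvgr_lt _ cv _ Xc.
  by exists (Y j) => //=; rewrite in_itv/=.
apply: countable_bigcupT_measurable => [|X]; first exact: countableP.
rewrite -[X in measurable X]setTI.
apply: (measurable_fun_sqnorm (measurable_mxB mF (measurable_mxM mG (measurable_mx_cst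
    _)))) => //.
Qed.

End residual_measurable.

(** * The expected residual for a fixed matrix *)

Section randomized_range_finder.
Context {dT : measure_display} {T : measurableType dT} {R : realType}.
Variable P : probability T R.
Context {m n r p : nat}.
Variable Omega : T -> 'M[R]_(n, r + p).
Hypothesis gOmega : gaussian_matrix P Omega.

Let measurable_mx_Omega : measurable_mx Omega.
Proof. by case: gOmega. Qed.

Lemma expectation_residual (A : 'M[R]_(m, n)) : (2 <= p)%N ->
  (\int[P]_w (sqnorm ((1%:M - col_projector (A *m Omega w)) *m A))%:E <=
   ((1 + r%:R / (p%:R - 1)) *
     \sum_(r.+1 <= j < (minn m n).+1) singular_value j A ^+ 2)%:E)%E.
Proof.
move=> p2; have [V [d [VV AAV d0 dE]]] := @dominant_subspace R m n A r.
rewrite -dE -(sqnorm_complement VV AAV) {dE}.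
set q := minn r n in V d VV AAV d0 *.
set B := A - A *m V *m V^T.
have BV : B *m V = 0 by rewrite mulmxBl -(mulmxA _ V^T V) VV mulmx1 subrr.
set c : R := r%:R / (p%:R - 1).
have p1 : 0 < p%:R - 1 :> R by rewrite subr_gt0 ltr1n.
have c0 : 0 <= c by rewrite divr_ge0// ltW.
set s := \sum_i d 0 i.
have s0 : 0 <= s by exact: sumr_ge0.
(* e is chosen so that the error term e s c is at most e'; the 1 in the denominator covers s c =
   0. *)
apply/lee_addgt0Pr => e' e'0; pose e := e' / (s * c + 1).
have sc0 : 0 < s * c + 1 by rewrite ltr_wpDl// mulr_ge0.
have e0 : 0 < e by rewrite divr_gt0.
pose W w := ridge_inv e (V^T *m Omega w); pose K w := ridge_pinv e (V^T *m Omega w).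
have qr : (q <= r)%N by exact: geq_minl.
(* With l = r + p and q <= r, l - q - 1 >= p - 1, so q / (l - q - 1) <= c; p >= 2 gives q + 1 <
   l. *)
have trW : (\int[P]_w (\tr (W w))%:E <= c%:E)%E.
  apply: le_trans (expectation_tr_ridge_inv gOmega VV e0 _) _.
    by rewrite -addn1 -addn1 -addnA leq_add.
  have rq : p%:R - 1 <= (r + p)%:R - q%:R - 1 :> R.
    have : q%:R <= r%:R :> R by rewrite ler_nat.
    rewrite natrD; lra.
  rewrite lee_fin ler_pM ?ler_nat ?invr_ge0 ?lef_pV2 ?posrE//.
  - by rewrite (le_trans (ltW p1)).
  - by rewrite (lt_le_trans p1).
have mG : measurable_mx (fun w => V^T *m Omega w).
  by apply: measurable_mxM => //; exact: measurable_mx_cst.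
have mW : measurable_mx W.
  apply: measurable_mx_inv; first by move=> w; exact: ridge_gram_unit.
  apply: measurable_mxD; last exact: measurable_mx_cst.
  by apply: measurable_mxM => //; exact: measurable_mxT.
have mK : measurable_mx K by apply: measurable_mxM => //; exact: measurable_mxT.
have mtrW : measurable_fun setT (fun w => (\tr (W w))%:E).
  by apply/measurable_EFinP; exact: measurable_fun_tr.
have trW0 w : 0 <= \tr (W w) by exact: tr_ridge_inv_ge0.
have mBOK : measurable_fun setT (fun w => (sqnorm (B *m Omega w *m K w))%:E).
  apply/measurable_EFinP/measurable_fun_sqnorm; apply: measurable_mxM => //.
  by apply: measurable_mxM => //; exact: measurable_mx_cst.
have BOK : (\int[P]_w (sqnorm (B *m Omega w *m K w))%:E <= (sqnorm B * c)%:E)%E.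
  rewrite (expectation_sqnorm_orth gOmega e0 BV).
  apply: (@le_trans _ _ (\int[P]_w ((sqnorm B)%:E * (\tr (W w))%:E))%E).
    apply: ge0_le_integral => //=.
    - by move=> w _; rewrite lee_fin mulr_ge0 ?sqnorm_ge0.
    - by apply/measurable_EFinP; apply: measurable_funM => //; exact: measurable_fun_sqnorm.
    - by apply/measurable_EFinP; apply: measurable_funM => //; exact/measurable_EFinP.
    - by move=> w _; rewrite lee_fin ler_wpM2l ?sqnorm_ge0// sqnorm_ridge_pinv_le.
  rewrite ge0_integralZl//=; last 2 first.
  - by move=> w _; rewrite lee_fin.
  - by rewrite lee_fin sqnorm_ge0.
  by rewrite EFinM lee_wpmul2l// lee_fin sqnorm_ge0.
have mres : measurable_fun setT (fun w => (sqnorm ((1%:M - col_projector (A *m Omega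
    w)) *m A))%:E).
  apply/measurable_EFinP; apply: measurable_residual; first exact: measurable_mx_cst.
  by apply: measurable_mxM => //; exact: measurable_mx_cst.
apply: (@le_trans _ _ (\int[P]_w ((sqnorm B)%:E + (sqnorm (B *m Omega w *m K w))%:E +
    (e * s)%:E * (\tr (W w))%:E))%E).
  apply: ge0_le_integral => //=.
  - by move=> w _; rewrite lee_fin sqnorm_ge0.
  - apply: emeasurable_funD; first exact: emeasurable_funD.
    exact: emeasurable_funM.
  - move=> w _; rewrite -EFinM -!EFinD lee_fin -mulrA.
    exact: (sketch_residual_le (Omega w) e0 erefl VV AAV d0).
rewrite ge0_integralD//=; last 4 first.
- by move=> w _; rewrite adde_ge0// lee_fin sqnorm_ge0.
- exact: emeasurable_funD.
- by move=> w _; rewrite mule_ge0// lee_fin// mulr_ge0// ltW.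
- exact: emeasurable_funM.
rewrite ge0_integralD//=; last 2 first.
- by move=> w _; rewrite lee_fin sqnorm_ge0.
- by move=> w _; rewrite lee_fin sqnorm_ge0.
rewrite integral_cst//= probability_setT mule1 ge0_integralZl//=; last 2 first.
- by move=> w _; rewrite lee_fin.
- by rewrite lee_fin mulr_ge0// ltW.
have es : ((e * s)%:E * \int[P]_w (\tr (W w))%:E <= e'%:E)%E.
  apply: (@le_trans _ _ ((e * s)%:E * c%:E)%E).
    by rewrite lee_wpmul2l// lee_fin mulr_ge0// ltW.
  rewrite -EFinM lee_fin.
  have -> : e * s * c = e' * (s * c / (s * c + 1)) by rewrite /e; ring.
  apply: ler_piMr; first exact: ltW.
  by rewrite ler_pdivrMr// mul1r lerDl.
rewrite mulrDl mul1r [c * _]mulrC EFinD.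
by rewrite !leeD.
Qed.

End randomized_range_finder.

(** * Integration over the compact domain *)

Section integral_domain.
Context {R : realType}.

(* Neither function need be measurable: the integral is a supremum over simple
   minorants. *)
Lemma le_nonneg_integral d (T : measurableType d) (mu : {measure set T -> \bar R})
    (f g : T -> \bar R) :
  (forall x, 0 <= f x)%E -> (forall x, f x <= g x)%E ->
  (\int[mu]_x f x <= \int[mu]_x g x)%E.
Proof.
move=> f0 fg; rewrite !ge0_integralTE//; last by move=> x; exact: le_trans (fg x).
apply: le_ereal_sup => _ [h hf <-]; exists h => // x.
exact: le_trans (hf x) (fg x).
Qed.

Lemma compact_measurable_rV d (D : set 'rV[R]_d) : compact D ->
  measurable (D : set (borel_rV R d)).
Proof.
move=> cD; rewrite -[D]setCK; apply: measurableC; apply: open_measurable_rV.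
by apply: closed_openC; apply: compact_closed => //; exact: norm_hausdorff.
Qed.

(** Continuity within D makes preimages of intervals relatively open, that is, open sets cut with
    the Borel set D. Extension by zero gives a function on the whole space, as used with Tonelli. *)
Lemma measurable_mx_continuous_on d m n (D : set 'rV[R]_d)
    (A : 'rV[R]_d -> 'M[R]_(m, n)) : compact D -> {within D, continuous A} ->
  measurable_mx (fun t : borel_rV R d => if t \in D then A t else 0).
Proof.
move=> cD cA i j.
have mD := compact_measurable_rV cD.
pose f := fun t : borel_rV R d => A t i j.
rewrite (_ : (fun t => _) = (f \_ D)); last first.
  by apply/funext => t; rewrite patchE; case: ifP => // _; rewrite mxE.
apply/measurable_restrict => //; rewrite setTI.
apply: (measurability _ (RGenOpens.measurableE R)) => _ [_ [a [b ->]] <-].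
have cf : {within D, continuous (fun t : 'rV[R]_d => A t i j)}.
  move=> t; apply: (@continuous_comp _ _ _ (A : subspace D -> _) (fun M :
      'M[R]_(m, n) => M i j)).
    exact: cA.
  exact: coord_continuous.
have oE : open ((fun t : subspace D => A t i j) @^-1` `]a, b[%classic).
  by apply: open_comp; [move=> t _; exact: cf|exact: interval_open].
have [U oU UD] := (open_subspaceP _ _).1 oE.
rewrite /f setIC -UD; apply: measurableI => //.
exact: open_measurable_rV.
Qed.

End integral_domain.

Theorem theorem5 (R : realType) (d m n r p : nat)
    (D : set 'rV[R]_d) (A : 'rV[R]_d -> 'M[R]_(m, n))
    (dT : measure_display) (T : measurableType dT) (P : probability T R)
    (Omega : T -> 'M[R]_(n, r + p)) :
  (2 <= r)%N -> (2 <= p)%N ->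
  compact D -> {within D, continuous A} ->
  gaussian_matrix P Omega ->
  (\int[P]_w \int[lebesgue_rV R d]_(t in D)
      (frobenius_norm
         ((1%:M - col_projector (A t *m Omega w)) *m A t) ^+ 2)%:E
   <= (1 + r%:R / (p%:R - 1))%:E *
      \int[lebesgue_rV R d]_(t in D)
        (\sum_(r.+1 <= j < (minn m n).+1) singular_value j (A t) ^+ 2)%:E)%E.
Proof.
move=> r2 p2 cD cA gO.
(* The residual of the zero matrix is 0, so points outside D contribute nothing. *)
pose A' (t : borel_rV R d) : 'M[R]_(m, n) := if t \in D then A t else 0.
have mA' : measurable_mx A' by exact: measurable_mx_continuous_on.
pose f (wt : T * borel_rV R d) : R :=
  sqnorm ((1%:M - col_projector (A' wt.2 *m Omega wt.1)) *m A' wt.2).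
have mf : measurable_fun setT f.
  have mA2 : measurable_mx (fun wt : T * borel_rV R d => A' wt.2).
    by move=> i j; exact: (measurableT_comp (mA' i j) measurable_snd).
  apply: measurable_residual => //; apply: measurable_mxM => // i j.
  by case: gO => mO _ _; exact: (measurableT_comp (mO i j) measurable_fst).
have mEf : measurable_fun setT (EFin \o f) by exact/measurable_EFinP.
have f0 wt : (0 <= (EFin \o f) wt)%E by rewrite lee_fin sqnorm_ge0.
set c : R := 1 + r%:R / (p%:R - 1).
have c0 : 0 < c.
  by rewrite ltr_pwDl// divr_ge0// subr_ge0 ler1n (leq_trans _ p2).
have LHS_E : (\int[P]_w \int[lebesgue_rV R d]_(t in D)
    (frobenius_norm ((1%:M - col_projector (A t *m Omega w)) *m A t) ^+ 2)%:E =
    \int[P]_w \int[lebesgue_rV R d]_t (f (w, t))%:E)%E.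
  apply: eq_integral => w _; rewrite integral_mkcond; apply: eq_integral => t _.
  rewrite patchE /f /A' /=; case: ifP => tD; first by rewrite sqnorm_frobenius.
  by rewrite mulmx0 sqnormE big1// => i _; rewrite big1// => j _; rewrite mxE expr0n.
rewrite LHS_E.
have FT := @fubini_tonelli _ _ _ _ _ P (lebesgue_rV R d) _ mEf f0.
rewrite /= in FT; rewrite FT.
pose g t := (\int[P]_w (f (w, t))%:E)%E.
have g0 t : (0 <= g t)%E by apply: integral_ge0 => w _; exact: f0.
have mg : measurable_fun setT g by exact: (@measurable_fun_fubini_tonelli_G _ _ _ _ _ P
    _ mEf f0).
(* The constant is extracted from the integral of [g], whose measurability Tonelli provides; the
   integrand with singular values then enters only through the pointwise comparison
   [le_nonneg_integral]. *)
have -> : (\int[lebesgue_rV R d]_t g t =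
    c%:E * \int[lebesgue_rV R d]_t (c^-1%:E * g t))%E.
  rewrite ge0_integralZl//; last by rewrite lee_fin invr_ge0 ltW.
  by rewrite muleA -EFinM divff ?mul1e// gt_eqF.
rewrite lee_wpmul2l//; first by rewrite lee_fin ltW.
rewrite [leRHS]integral_mkcond; apply: le_nonneg_integral => t.
  by rewrite mule_ge0// lee_fin invr_ge0 ltW.
rewrite patchE /g /f /A' /=; case: ifP => tD.
  rewrite lee_pdivrMl//.
  exact: (expectation_residual gO (A t) p2).
rewrite integral0_eq ?mule0// => w _.
by rewrite mulmx0 sqnormE big1// => i _; rewrite big1// => j _; rewrite mxE expr0n.
Qed.
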